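(* The following statements hold: (1) $\Gamma_c(H_1,H_2)$ is dense in $\mathcal C(H_1,H_2)$ with respect to the gap metric $\theta(\cdot,\cdot)$. (2) $\Gamma_c(H_1,H_2)$ is dense in $\mathcal C(H_1,H_2)$ with respect to the metric $\eta(\cdot,\cdot)$. (3) The set of all closed range operators in $\mathcal C(H_1,H_2)$ is dense in $\mathcal C(H_1,H_2)$ with respect to the metric $\theta(\cdot,\cdot)$. (4) The set of all closed range operators in $\mathcal C(H_1,H_2)$ is dense in $\mathcal C(H_1,H_2)$ with respect to the metric $\eta(\cdot,\cdot)$.
   Context: $H_1,H_2$ are infinite dimensional complex Hilbert spaces. $\mathcal C(H_1,H_2)$ denotes the class of densely defined closed linear operators from a dense subspace $D(T)\subseteq H_1$ into $H_2$. $N(T)$ denotes the null space of $T$, and $C(T):=D(T)\cap N(T)^{\perp}$ is its carrier. The reduced minimum modulus is $\gamma(T):=\inf\{\|Tx\|: x\in C(T),\ \|x\|=1\}$. $\Gamma_c(H_1,H_2)$ is the set of $T\in\mathcal C(H_1,H_2)$ that attain their reduced minimum, i.e. for which there is $x_0\in C(T)$ with $\|x_0\|=1$ and $\|Tx_0\|=\gamma(T)$. $P_M$ is the orthogonal projection onto a closed subspace $M$. The graph of $T$ is $G(T)=\{(x,Tx):x\in D(T)\}\subseteq H_1\times H_2$ and the carrier graph is $G_C(T)=\{(x,Tx):x\in C(T)\}\subseteq H_1\times H_2$; both are closed subspaces of the Hilbert space $H_1\times H_2$. The gap metric is $\theta(S,T):=\|P_{G(S)}-P_{G(T)}\|$ and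 the carrier graph metric is $\eta(S,T):=\|P_{G_C(S)}-P_{G_C(T)}\|$. An operator has closed range if $R(T)$ is closed in $H_2$.
   Formalization: In (2) the operator being approximated is assumed nonzero: for T = 0 the carrier is {0}, so 0 is not in Γ_c and every S in Γ_c has η(S,0) = 1, which makes (2) false at T = 0. *)

(* Defs.v *)
From HB Require Import structures.
From mathcomp Require Import all_boot all_order all_algebra.
From mathcomp Require Import all_classical all_reals all_analysis.
From mathcomp Require Import sesquilinear complex.

Set Implicit Arguments.
Unset Strict Implicit.
Unset Printing Implicit Defensive.

Import Order.TTheory GRing.Theory Num.Theory.
Import numFieldNormedType.Exports.

Local Open Scope classical_set_scope.
Local Open Scope complex_scope.
Local Open Scope ring_scope.

(* Complex Hilbert spaces: the inner product is linear in its first argument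
   and conjugate-linear in the second. *)
HB.mixin Record CompleteNormedModule_isHilbert (R : realType) H
    & CompleteNormedModule R[i] H := {
  hdot : {dot H for (@Num.conj R[i])} ;
  hdot_norm : forall x : H, `|x| ^+ 2 = hdot x x
}.

#[short(type="hilbertType")]
HB.structure Definition Hilbert (R : realType) :=
  {H of CompleteNormedModule R[i] H & CompleteNormedModule_isHilbert R H}.

Definition infinite_dimensional (R : realType) (H : hilbertType R) : Prop :=
  forall s : seq H, exists x : H,
    ~ exists c : 'I_(size s) -> R[i], x = \sum_(i < size s) c i *: s`_i.

Section InnerProductSpace.
Context {R : realType} {V : lmodType R[i]}.
Variable f : {dot V for (@Num.conj R[i])}.

Definition dnorm (v : V) : R := Num.sqrt (complex.Re (f v v)).

(* The value 0 is used when there is no such p; this does not happen when M is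
   a closed subspace of a Hilbert space. *)
Definition orthoproj (M : set V) (v : V) : V :=
  xget 0 [set p | M p /\ forall m, M m -> f (v - p) m = 0].

Definition opnorm (A : V -> V) : \bar R :=
  ereal_sup [set (dnorm (A v))%:E | v in [set v | dnorm v <= 1]].

End InnerProductSpace.

(* H1 * H2 carries the topology of the Hilbert space product, but its library
   norm is the max norm: norms and orthogonality on H1 * H2 are always taken
   with respect to prod_dot. *)
Section ProductInnerProduct.
Context {R : realType} {H1 H2 : hilbertType R}.

Definition prod_dot (z w : H1 * H2) : R[i] :=
  hdot z.1 w.1 + hdot z.2 w.2.

Let prod_dot_linearl w :
  GRing.linear_for *%R (fun z : H1 * H2 => prod_dot z w).
Proof.
move=> a u v; rewrite /prod_dot /= !linearDl !linearZl_LR /=.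
by rewrite mulrDr addrACA.
Qed.

Let prod_dot_linearr z :
  GRing.linear_for (@Num.conj R[i] \; *%R) (fun w : H1 * H2 => prod_dot z w).
Proof.
move=> a u v; rewrite /prod_dot /= !linearDr !linearZr_LR /=.
by rewrite addrACA -mulrDr.
Qed.

HB.instance Definition _ := bilinear_isBilinear.Build R[i] (H1 * H2)%type
  (H1 * H2)%type R[i] *%R (@Num.conj R[i] \; *%R) prod_dot
  (prod_dot_linearl, prod_dot_linearr).

Let prod_dot_herm (z w : H1 * H2) :
  prod_dot z w = (-1) ^+ false * Num.conj (prod_dot w z).
Proof.
rewrite /prod_dot expr0 mul1r rmorphD /=.
by congr (_ + _); rewrite [LHS]hermC expr0 mul1r.
Qed.

HB.instance Definition _ := isHermitianSesquilinear.Build R[i] (H1 * H2)%type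
  false (@Num.conj R[i]) prod_dot prod_dot_herm.

Let prod_dot_gt0 (z : H1 * H2) : z != 0 -> 0 < prod_dot z z.
Proof.
move=> z0; rewrite /prod_dot lt_def addr_ge0 ?dnorm_ge0 // andbT.
apply: contra z0; rewrite paddr_eq0 ?dnorm_ge0 // !dnorm_eq0.
by case: z => x y /= /andP[/eqP -> /eqP ->].
Qed.

HB.instance Definition _ := isDotProduct.Build R[i] (H1 * H2)%type
  prod_dot prod_dot_gt0.

End ProductInnerProduct.

(* The class C(H1, H2). An operator is given by its domain together with a
   total function whose values off the domain are irrelevant. *)
Record cdop (R : realType) (H1 H2 : hilbertType R) := CDOp {
  dom : set H1 ;
  op_fun :> H1 -> H2 ;
  dom0 : dom 0 ;
  dom_linear : forall (a : R[i]) x y, dom x -> dom y -> dom (a *: x + y) ;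
  op_linear : forall (a : R[i]) x y, dom x -> dom y ->
    op_fun (a *: x + y) = a *: op_fun x + op_fun y ;
  dom_dense : dense dom ;
  graph_closed : closed [set z : H1 * H2 | dom z.1 /\ z.2 = op_fun z.1]
}.

Section ClosedOperators.
Context {R : realType} {H1 H2 : hilbertType R}.
Implicit Types (S T : cdop H1 H2).

Definition graph T : set (H1 * H2) := [set z | dom T z.1 /\ z.2 = T z.1].

Definition null_space T : set H1 := [set x | dom T x /\ T x = 0].

Definition carrier T : set H1 :=
  [set x | dom T x /\ forall y, null_space T y -> hdot x y = 0].

Definition carrier_graph T : set (H1 * H2) :=
  [set z | carrier T z.1 /\ z.2 = T z.1].

Definition op_range T : set H2 := [set T x | x in dom T].

Definition closed_range : set (cdop H1 H2) :=
  [set T | closed (op_range T)].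

(* Extended-real valued: the infimum over an empty carrier sphere is +oo. *)
Definition reduced_min_modulus T : \bar R :=
  ereal_inf [set (dnorm hdot (T x))%:E
            | x in [set x | carrier T x /\ dnorm hdot x = 1]].

Definition reduced_min_attaining : set (cdop H1 H2) :=
  [set T | exists x, [/\ carrier T x, dnorm hdot x = 1 &
                         (dnorm hdot (T x))%:E = reduced_min_modulus T]].

Definition gap_metric S T : \bar R :=
  opnorm prod_dot
    (fun z => orthoproj prod_dot (graph S) z - orthoproj prod_dot (graph T) z).

Definition carrier_graph_metric S T : \bar R :=
  opnorm prod_dot
    (fun z => orthoproj prod_dot (carrier_graph S) z
              - orthoproj prod_dot (carrier_graph T) z).

(* The zero operator has carrier {0}. Hence it does not attain its reduced
   minimum, and it is at carrier graph distance 1 from every other operator. *)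
Definition nonzero_op : set (cdop H1 H2) :=
  [set T | exists2 x, dom T x & T x != 0].

End ClosedOperators.

Definition dense_wrt (R : realType) (X : Type) (d : X -> X -> \bar R)
    (A B : set X) : Prop :=
  forall x, B x -> forall e : R, 0 < e ->
    exists2 a, A a & (d a x < e%:E)%E.

(* Main.v *)
From HB Require Import structures.
Require Import Defs.
From mathcomp Require Import all_boot all_order all_algebra.
From mathcomp Require Import all_classical all_reals all_analysis.
From mathcomp Require Import sesquilinear complex.
From mathcomp Require Import ring lra.

(* Every approximant is [S x = T x + B (x, T x)] with [B] linear and small on
   [H1 * H2]; such an [S] has the domain of [T] and a graph close to that of
   [T], and if [B] vanishes on [N(T) * 0] and [S] stays bounded below on the
   carrier of [T], then [N(S) = N(T)] and the carrier graphs are close as well.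
   To make [T] bounded below on its carrier, hence of closed range, let [W] be
   the isometric factor in the polar decomposition of the bounded second
   projection of the carrier graph and take [B = d W]: no spectral theory of
   the unbounded [T] is needed, only the square root of a bounded positive
   operator. If [T] is bounded below with reduced minimum modulus [g], a small
   rank one perturbation lowers the norm of [T x] at one almost minimising [x]
   strictly below [g]; the infimum then lies below the values available on a
   subspace of codimension one, and minimising sequences converge. *)

Set Implicit Arguments.
Unset Strict Implicit.
Unset Printing Implicit Defensive.

Import Order.TTheory GRing.Theory Num.Theory.
Import numFieldNormedType.Exports.
Import Normc.

Local Open Scope classical_set_scope.
Local Open Scope complex_scope.
Local Open Scope ring_scope.

(** * Real sequences tending to zero *)

Section NullSequences.
Context {R : realType}.
Implicit Types r s : nat -> R.

Definition null_seq r := r @ \oo --> (0 : R).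

Lemma null_seq_le r s : (forall n, 0 <= r n <= s n) -> null_seq s -> null_seq r.
Proof.
move=> rs s0; apply: (@squeeze_cvgr _ _ _ _ (fun=> 0) s r) => //.
- by apply: nearW => n; exact: rs.
- exact: cvg_cst.
Qed.

Lemma null_seqD r s : null_seq r -> null_seq s -> null_seq (fun n => r n + s n).
Proof. by move=> r0 s0; rewrite /null_seq -[0]addr0; exact: cvgD. Qed.

Lemma null_seqZ c r : null_seq r -> null_seq (fun n => c * r n).
Proof. by move=> r0; rewrite /null_seq -[0](mulr0 c); apply: cvgMr. Qed.

Lemma null_seq_sqrt r : null_seq r -> null_seq (fun n => Num.sqrt (r n)).
Proof.
move=> r0; rewrite /null_seq -sqrtr0.
by apply: continuous_cvg => //; exact: sqrt_continuous.
Qed.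

Lemma null_seq_harmonic : null_seq (fun n => n.+1%:R^-1).
Proof. exact: cvg_harmonic. Qed.

(** Norm inequalities are passed to the limit in this form: they are first proved up to an error
    that tends to zero. *)
Lemma le_null_seq (a b : R) r : null_seq r -> (forall n, a <= b + r n) -> a <= b.
Proof.
move=> r0 ab; rewrite -[leRHS]addr0.
have br : (fun n => b + r n) @ \oo --> b + 0 by apply: cvgD => //; exact: cvg_cst.
rewrite -(cvg_lim (@Rhausdorff R) br); apply: limr_ge; first by apply/cvg_ex; exists (b + 0).
exact: nearW.
Qed.

Lemma null_seq_lt r (e : R) : null_seq r -> 0 < e ->
  exists N, forall n, (N <= n)%N -> `|r n| < e.
Proof.
move=> /cvgrPdist_lt/[apply] -[N _ NP].
by exists N => n Nn; have := NP n Nn; rewrite sub0r normrN.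
Qed.

End NullSequences.

(** * Inner product spaces and orthogonal projections *)

Section InnerProduct.
Context {R : realType} {V : lmodType R[i]}.
Variable f : {dot V for (@Num.conj R[i])}.
Implicit Types (u v w : V) (a : R[i]).
Local Notation N := (dnorm f).

Lemma dotC u v : f u v = (f v u)^*%C.
Proof. by rewrite hermC expr0 mul1r. Qed.

Lemma dotDl u v w : f (u + v) w = f u w + f v w. Proof. exact: linearDl. Qed.

Lemma dotDr u v w : f w (u + v) = f w u + f w v. Proof. exact: linearDr. Qed.

Lemma dotBl u v w : f (u - v) w = f u w - f v w. Proof. exact: linearBl. Qed.

Lemma dotBr u v w : f w (u - v) = f w u - f w v. Proof. exact: linearBr. Qed.

Lemma dotZl a u w : f (a *: u) w = a * f u w. Proof. by rewrite linearZl_LR. Qed.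

Lemma dotZr a u w : f w (a *: u) = a^*%C * f w u.
Proof. by rewrite dotC dotZl rmorphM (dotC w u). Qed.

Lemma dot0l w : f 0 w = 0. Proof. exact: linear0l. Qed.

Lemma dot0r w : f w 0 = 0. Proof. exact: linear0r. Qed.

Lemma dot_eq0C u v : f u v = 0 -> f v u = 0.
Proof. by move=> uv; rewrite dotC uv rmorph0. Qed.

Lemma dotvv u : f u u = (N u ^+ 2)%:C.
Proof.
have := dnorm_ge0 f u; rewrite /dnorm; case: (f u u) => x y.
by rewrite lecE /= => /andP[/eqP-> x0]; rewrite sqr_sqrtr.
Qed.

Lemma dnormv_ge0 u : 0 <= N u. Proof. exact: sqrtr_ge0. Qed.
Hint Resolve dnormv_ge0 : core.

Lemma dnormv_eq0 u : (N u == 0) = (u == 0).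
Proof. by rewrite -(dnorm_eq0 f u) dotvv eq_complex /= eqxx andbT sqrf_eq0. Qed.

Lemma dnorm0 : N 0 = 0. Proof. by apply/eqP; rewrite dnormv_eq0. Qed.

Lemma dnormv_gt0 u : (0 < N u) = (u != 0).
Proof. by rewrite lt_def dnormv_ge0 andbT dnormv_eq0. Qed.

Lemma normc_sqr (a : R[i]) : a * a^*%C = (normc a ^+ 2)%:C.
Proof.
case: a => x y /=; rewrite sqr_sqrtr ?addr_ge0 ?sqr_ge0 //.
by apply/eqP; rewrite eq_complex /=; apply/andP; split; apply/eqP; ring.
Qed.

Lemma normc_real (x : R) : normc x%:C = `|x|.
Proof. by rewrite /= expr0n /= addr0 sqrtr_sqr. Qed.

Lemma Re_conjM_scale (x : R) (a : R[i]) :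
  complex.Re ((x%:C * a)^*%C * a) = x * normc a ^+ 2.
Proof. by case: a => y z /=; rewrite sqr_sqrtr ?addr_ge0 ?sqr_ge0 //; ring. Qed.

Lemma normc_ge0 (a : R[i]) : 0 <= normc a.
Proof. by case: a => x y; exact: sqrtr_ge0. Qed.

Lemma dnormvZ a u : N (a *: u) = normc a * N u.
Proof.
apply/eqP; rewrite -(@eqrXn2 _ 2) ?mulr_ge0 ?normc_ge0 //.
apply/eqP; apply: complexI; rewrite -dotvv dotZl dotZr mulrA normc_sqr dotvv.
by rewrite exprMn -rmorphM.
Qed.

Lemma dnormvZr (x : R) u : 0 <= x -> N (x%:C *: u) = x * N u.
Proof. by move=> x0; rewrite dnormvZ normc_real ger0_norm. Qed.

Lemma dnormvN u : N (- u) = N u.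
Proof. by rewrite -scaleN1r dnormvZ normcN normc1 mul1r. Qed.

Lemma ddistC u v : N (u - v) = N (v - u).
Proof. by rewrite -dnormvN opprB. Qed.

Lemma dnormvD_sqr u v : N (u + v) ^+ 2 = N u ^+ 2 + N v ^+ 2 + complex.Re (f u v) *+ 2.
Proof.
apply: complexI; rewrite -dotvv dotDl !dotDr !dotvv (dotC v u).
by case: (f u v) => x y; apply/eqP; rewrite eq_complex /=; apply/andP; split; apply/eqP; ring.
Qed.

Lemma dnormvB_sqr u v : N (u - v) ^+ 2 = N u ^+ 2 + N v ^+ 2 - complex.Re (f u v) *+ 2.
Proof.
rewrite dnormvD_sqr dnormvN -scaleN1r dotZr.
by congr (_ + _); case: (f u v) => x y /=; ring.
Qed.

Lemma dnormv_pythagoras u v : f u v = 0 -> N (u + v) ^+ 2 = N u ^+ 2 + N v ^+ 2.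
Proof. by rewrite dnormvD_sqr => ->; rewrite mul0rn addr0. Qed.

Lemma parallelogram u v :
  N (u + v) ^+ 2 + N (u - v) ^+ 2 = 2 * N u ^+ 2 + 2 * N v ^+ 2.
Proof. by rewrite dnormvD_sqr dnormvB_sqr; ring. Qed.

(** Expand [0 <= N (u - t *: v) ^+ 2], where [t *: v] is the projection of [u] on the line of
    [v]. *)
Lemma dot_cauchy_schwarz u v : normc (f u v) <= N u * N v.
Proof.
have [->|v0] := eqVneq v 0; first by rewrite dot0r dnorm0 normc0 mulr0.
have Nv : 0 < N v by rewrite dnormv_gt0.
pose t : R[i] := ((N v ^+ 2)^-1)%:C * f u v.
have := sqr_ge0 (N (u - t *: v)); rewrite dnormvB_sqr dotZr dnormvZ.
have -> : complex.Re (t^*%C * f u v) = (N v ^+ 2)^-1 * normc (f u v) ^+ 2.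
  exact: Re_conjM_scale.
rewrite /t normcM normc_real ger0_norm ?invr_ge0 ?sqr_ge0 //.
set c := normc _ => H.
rewrite -(@ler_pXn2r _ 2) ?nnegrE ?mulr_ge0 ?normc_ge0 //.
have E : N u ^+ 2 + (N v ^- 2 * c * N v) ^+ 2 - (N v ^- 2 * c ^+ 2) *+ 2 =
  N v ^- 2 * ((N u * N v) ^+ 2 - c ^+ 2) by field; rewrite gt_eqF.
by move: H; rewrite E pmulr_rge0 ?invr_gt0 ?exprn_gt0 // subr_ge0.
Qed.

Lemma Re_dot_le u v : `|complex.Re (f u v)| <= N u * N v.
Proof.
apply: le_trans (dot_cauchy_schwarz u v).
by case: (f u v) => x y /=; rewrite -sqrtr_sqr ler_wsqrtr // lerDl sqr_ge0.
Qed.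

Lemma dnormvD u v : N (u + v) <= N u + N v.
Proof.
rewrite -(@ler_pXn2r _ 2) ?nnegrE ?addr_ge0 // dnormvD_sqr sqrrD addrAC lerD2r.
by rewrite lerD2l lerMn2r /= (le_trans (ler_norm _)) // Re_dot_le.
Qed.

Lemma dnormvB u v : N (u - v) <= N u + N v.
Proof. by rewrite -(dnormvN v) dnormvD. Qed.

Lemma ddistD w u v : N (u - v) <= N (u - w) + N (w - v).
Proof. by rewrite -{1}(subrK w u) -addrA dnormvD. Qed.

Lemma dnormv_leD u v : N u <= N v + N (u - v).
Proof. by rewrite -{1}(subrK v u) addrC dnormvD. Qed.

(** * Norm limits and Cauchy sequences *)

Definition dlim (s : nat -> V) l := null_seq (fun n => N (s n - l)).

(** The bound is split into one null sequence evaluated at both indices, so that estimates on single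
    terms add up without any choice of thresholds. *)
Definition dcauchy (s : nat -> V) := exists2 r : nat -> R, null_seq r &
  forall m n, N (s m - s n) <= r m + r n.

Lemma dlim_le (r : nat -> R) s l :
  null_seq r -> (forall n, N (s n - l) <= r n) -> dlim s l.
Proof. by move=> r0 sr; apply: null_seq_le r0 => n; rewrite dnormv_ge0 sr. Qed.

Lemma dlim_cauchy s l : dlim s l -> dcauchy s.
Proof. by exists (fun n => N (s n - l)) => // m n; rewrite (ddistC (s n)) ddistD. Qed.

Lemma dlim_unique s l l' : dlim s l -> dlim s l' -> l = l'.
Proof.
move=> sl sl'; apply/eqP; rewrite -subr_eq0 -dnormv_eq0 eq_le dnormv_ge0 andbT.
have := le_null_seq (null_seqD sl sl'); apply => n.
by rewrite add0r (ddistC (s n) l) ddistD.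
Qed.

Lemma dlimD s t l m : dlim s l -> dlim t m -> dlim (fun n => s n + t n) (l + m).
Proof.
move=> sl tm; apply: dlim_le (null_seqD sl tm) _ => n.
by rewrite opprD addrACA dnormvD.
Qed.

Lemma dlimZ a s l : dlim s l -> dlim (fun n => a *: s n) (a *: l).
Proof.
move=> sl; apply: dlim_le (null_seqZ (normc a) sl) _ => n.
by rewrite -scalerBr dnormvZ.
Qed.

(** Since [sqrt (a + b) <= sqrt a + sqrt b], bounds on squared distances, as the parallelogram law
    provides them, are enough. *)
Lemma dcauchy_sqr s (r : nat -> R) : null_seq r -> (forall n, 0 <= r n) ->
  (forall m n, N (s m - s n) ^+ 2 <= r m + r n) -> dcauchy s.
Proof.
move=> r0 rp sr; exists (fun n => Num.sqrt (r n)); first exact: null_seq_sqrt.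
move=> m n; rewrite -(@ler_pXn2r _ 2) ?nnegrE ?addr_ge0 ?sqrtr_ge0 //.
apply: le_trans (sr m n) _; rewrite sqrrD !sqr_sqrtr // addrAC lerDl.
by rewrite mulrn_wge0 // mulr_ge0 ?sqrtr_ge0.
Qed.

Lemma dlim_dot0 s l v : dlim s l -> (forall n, f (s n) v = 0) -> f l v = 0.
Proof.
move=> sl sv; apply: eq0_normc; apply/eqP; rewrite eq_le normc_ge0 andbT.
apply: (le_null_seq (null_seqZ (N v) sl)) => n.
rewrite add0r -normcN -[- _]add0r -(sv n) -dotBl mulrC.
exact: dot_cauchy_schwarz.
Qed.

Lemma dlim_norm_le s l (c : R) : dlim s l -> (forall n, N (s n) <= c) -> N l <= c.
Proof.
move=> sl sc; apply: (le_null_seq sl) => n.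
by rewrite (ddistC (s n)) (le_trans (dnormv_leD l (s n))) // lerD2r.
Qed.

(** * Complete subspaces and orthogonal projections *)

Definition linear_subspace (M : set V) :=
  M 0 /\ forall a u v, M u -> M v -> M (a *: u + v).

Definition dcomplete (M : set V) := forall s, (forall n, M (s n)) -> dcauchy s ->
  exists2 l, M l & dlim s l.

Definition seq_closed (M : set V) := forall s l, (forall n, M (s n)) -> dlim s l -> M l.

Lemma seq_closed_complete M : dcomplete setT -> seq_closed M -> dcomplete M.
Proof.
move=> cT cM s sM cs; have [l _ sl] := cT s (fun=> I) cs.
by exists l => //; exact: cM sM sl.
Qed.

Section Subspace.
Variable M : set V.
Hypothesis sM : linear_subspace M.

Lemma subspaceD u v : M u -> M v -> M (u + v).
Proof. by move=> Mu Mv; rewrite -[u]scale1r; apply: sM.2. Qed.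

Lemma subspaceZ a u : M u -> M (a *: u).
Proof. by move=> Mu; rewrite -[_ *: _]addr0; apply: sM.2 => //; exact: sM.1. Qed.

Lemma subspaceB u v : M u -> M v -> M (u - v).
Proof. by move=> Mu Mv; rewrite -scaleN1r; apply: subspaceD => //; exact: subspaceZ. Qed.

(** Subtracting from [w] its component [t *: m] along [m] lowers the squared norm by
    [|f w m|^2 / |m|^2], which minimality forces to vanish. *)
Lemma orthogonal_of_min w : (forall m, M m -> N w <= N (w - m)) ->
  forall m, M m -> f w m = 0.
Proof.
move=> wmin m Mm; have [->|m0] := eqVneq m 0; first by rewrite dot0r.
have Nm : 0 < N m by rewrite dnormv_gt0.
pose t : R[i] := ((N m ^+ 2)^-1)%:C * f w m.
have := wmin (t *: m) (subspaceZ t Mm).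
rewrite -(@ler_pXn2r _ 2) ?nnegrE // dnormvB_sqr dotZr dnormvZ.
have -> : complex.Re (t^*%C * f w m) = (N m ^+ 2)^-1 * normc (f w m) ^+ 2.
  exact: Re_conjM_scale.
rewrite /t normcM normc_real ger0_norm ?invr_ge0 ?sqr_ge0 //.
set c := normc _ => H; apply: eq0_normc; rewrite -/c.
have E : N w ^+ 2 + (N m ^- 2 * c * N m) ^+ 2 - (N m ^- 2 * c ^+ 2) *+ 2 =
  N w ^+ 2 - N m ^- 2 * c ^+ 2 by field; rewrite gt_eqF.
move: H; rewrite E lerDl oppr_ge0 pmulr_rle0 ?invr_gt0 ?exprn_gt0 // => H.
by apply/eqP; rewrite -sqrf_eq0 eq_le H sqr_ge0.
Qed.

Hypothesis cM : dcomplete M.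

(** A sequence in [M] minimising the squared distance to [z] is Cauchy by the parallelogram law. Its
    limit realises the distance, so the residual is orthogonal to [M]. *)
Lemma orthoproj_exists z : exists p, M p /\ forall m, M m -> f (z - p) m = 0.
Proof.
pose D := [set N (z - m) ^+ 2 | m in M].
have D0 : has_inf D.
  split; first by exists (N (z - 0) ^+ 2), 0 => //; exact: sM.1.
  by exists 0 => _ [m _ <-]; exact: sqr_ge0.
have Dinf m : M m -> inf D <= N (z - m) ^+ 2.
  by move=> Mm; apply: ge_inf; [exact: D0.2 | exists m].
have /choice[s sP] (n : nat) : exists m, M m /\ N (z - m) ^+ 2 < inf D + n.+1%:R^-1.
  have [_ [m Mm <-] ms] := inf_adherent (ltac:(by rewrite invr_gt0) : 0 < n.+1%:R^-1 :> R) D0.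
  by exists m.
have cs : dcauchy s.
  apply: (@dcauchy_sqr s (fun n => 2 * n.+1%:R^-1)).
  - exact/null_seqZ/null_seq_harmonic.
  - by move=> n; rewrite mulr_ge0 // invr_ge0.
  move=> m n; have [Mm Hm] := sP m; have [Mn Hn] := sP n.
  have := parallelogram (z - s m) (z - s n).
  have -> : z - s m - (z - s n) = s n - s m by rewrite opprB addrC addrA subrK.
  rewrite (ddistC (s n)).
  (* The sum is twice the distance vector to the midpoint, which lies in [M] and is therefore at
     squared distance at least [inf D]. *)
  have -> : z - s m + (z - s n) = 2%:R%:C *: (z - 2%:R^-1%:C *: (s m + s n)).
    rewrite scalerBr scalerA -rmorphM mulfV // scale1r addrACA -opprD.
    by rewrite rmorph_nat scaler_nat mulr2n.
  rewrite dnormvZr // exprMn.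
  have := Dinf _ (subspaceZ (2%:R^-1%:C) (subspaceD Mm Mn)).
  move: Hm Hn; move: (m.+1%:R^-1) (n.+1%:R^-1) (inf D) => x y d.
  move: (N (z - s m) ^+ 2) (N (z - s n) ^+ 2) (N (s m - s n) ^+ 2) => A B C.
  move: (N _ ^+ 2) => E; lra.
have [p Mp sp] := cM (fun n => (sP n).1) cs.
exists p; split=> //; apply: orthogonal_of_min => m Mm.
have Iz : N (z - p) <= Num.sqrt (inf D).
  have := null_seqD (null_seq_sqrt (@null_seq_harmonic R)) sp.
  move=> /le_null_seq; apply => n.
  apply: le_trans (ddistD (s n) _ _) _; rewrite addrA lerD2r.
  have I0 : 0 <= inf D by apply: lb_le_inf; [exact: D0.1 | move=> _ [? _ <-]; exact: sqr_ge0].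
  rewrite -(@ler_pXn2r _ 2) ?nnegrE ?addr_ge0 ?sqrtr_ge0 //.
  apply: le_trans (ltW (sP n).2) _.
  by rewrite sqrrD !sqr_sqrtr ?invr_ge0 // addrAC lerDl mulrn_wge0 // mulr_ge0 ?sqrtr_ge0.
apply: le_trans Iz _.
have -> : z - p - m = z - (p + m) by rewrite opprD addrA.
rewrite -(ger0_norm (dnormv_ge0 (z - (p + m)))) -sqrtr_sqr ler_wsqrtr // Dinf //.
exact: subspaceD.
Qed.

Local Notation P := (orthoproj f M).

Lemma orthoprojP z : M (P z) /\ forall m, M m -> f (z - P z) m = 0.
Proof. by rewrite /orthoproj; case: xgetP => [p -> //|H]; have [p /H] := orthoproj_exists z. Qed.

Lemma orthoproj_in z : M (P z). Proof. exact: (orthoprojP z).1. Qed.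

Lemma orthoproj_orth z m : M m -> f (z - P z) m = 0.
Proof. exact: (orthoprojP z).2. Qed.

Lemma orthoproj_eq z p : M p -> (forall m, M m -> f (z - p) m = 0) -> P z = p.
Proof.
move=> Mp zp; apply/eqP; rewrite -subr_eq0 -dnormv_eq0 -sqrf_eq0.
have Mq := subspaceB (orthoproj_in z) Mp.
suff : ((N (P z - p) ^+ 2)%:C : R[i]) = 0 by move/complexI => ->.
rewrite -dotvv.
have -> : f (P z - p) (P z - p) = f (z - p) (P z - p) - f (z - P z) (P z - p).
  by rewrite -dotBl opprB [z - p + _]addrC addrA subrK.
by rewrite zp // orthoproj_orth // subrr.
Qed.

Lemma orthoproj_id m : M m -> P m = m.
Proof. by move=> Mm; apply: orthoproj_eq => // m' _; rewrite subrr dot0l. Qed.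

Lemma orthoproj_perp z : (forall m, M m -> f z m = 0) -> P z = 0.
Proof. by move=> zM; apply: orthoproj_eq; [exact: sM.1 | rewrite subr0]. Qed.

Lemma orthoproj_linear : linear P.
Proof.
move=> a u v; apply: orthoproj_eq.
  by apply: sM.2; exact: orthoproj_in.
move=> m Mm; rewrite opprD addrACA -scalerBr dotDl dotZl !orthoproj_orth //.
by rewrite mulr0 addr0.
Qed.

Lemma orthoproj_sym u v : f (P u) v = f u (P v).
Proof.
have -> : f (P u) v = f (P u) (P v).
  apply/eqP; rewrite -subr_eq0 -dotBr; apply/eqP/dot_eq0C/orthoproj_orth.
  exact: orthoproj_in.
apply/esym/eqP; rewrite -subr_eq0 -dotBl; apply/eqP/orthoproj_orth.
exact: orthoproj_in.
Qed.

Lemma orthoproj_pythagoras z : N z ^+ 2 = N (P z) ^+ 2 + N (z - P z) ^+ 2.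
Proof.
rewrite -dnormv_pythagoras; first by rewrite addrC subrK.
by apply: dot_eq0C; apply: orthoproj_orth; exact: orthoproj_in.
Qed.

Lemma orthoproj_le z : N (P z) <= N z.
Proof.
by rewrite -(@ler_pXn2r _ 2) ?nnegrE // [leRHS]orthoproj_pythagoras lerDl sqr_ge0.
Qed.

Lemma orthoproj_dist z m : M m -> N (z - P z) <= N (z - m).
Proof.
move=> Mm; have -> : z - m = z - P z + (P z - m) by rewrite addrA subrK.
rewrite -(@ler_pXn2r _ 2) ?nnegrE // [leRHS]dnormv_pythagoras ?lerDl ?sqr_ge0 //.
by apply: orthoproj_orth; apply: subspaceB => //; exact: orthoproj_in.
Qed.

End Subspace.

(* [P' - P] is [(1 - P) P' - P (1 - P')], whose last term is the adjoint of
   [(1 - P') P]. *)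
Lemma orthoproj_gap_le M M' (d : R) :
  linear_subspace M -> dcomplete M -> linear_subspace M' -> dcomplete M' -> 0 <= d ->
  (forall m, M m -> exists2 m', M' m' & N (m - m') <= d * N m) ->
  (forall m', M' m' -> exists2 m, M m & N (m' - m) <= d * N m') ->
  forall z, N (orthoproj f M' z - orthoproj f M z) <= 2 * d * N z.
Proof.
move=> sM cM sM' cM' d0 MM' M'M z.
set P := orthoproj f M; set P' := orthoproj f M'.
have near u : N (P' u - P (P' u)) <= d * N u.
  have [m Mm um] := M'M _ (orthoproj_in sM' cM' u).
  apply: le_trans (orthoproj_dist sM cM _ Mm) (le_trans um _).
  by rewrite ler_wpM2l // orthoproj_le.
have near' u : N (P u - P' (P u)) <= d * N u.
  have [m Mm um] := MM' _ (orthoproj_in sM cM u).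
  apply: le_trans (orthoproj_dist sM' cM' _ Mm) (le_trans um _).
  by rewrite ler_wpM2l // orthoproj_le.
set w := P (z - P' z).
have w_le : N w <= d * N z.
  have [w0|w0] := eqVneq (N w) 0; first by rewrite w0 mulr_ge0.
  have Nw : 0 < N w by rewrite lt_def w0 dnormv_ge0.
  rewrite -(ler_pM2r Nw) -expr2.
  have Pw : P w = w by apply: orthoproj_id => //; exact: orthoproj_in.
  have E : f w w = f z (w - P' w).
    have := orthoproj_sym sM cM (z - P' z) w; rewrite -/P -/w Pw => ->.
    by rewrite dotBl dotBr (orthoproj_sym sM' cM').
  have -> : N w ^+ 2 = complex.Re (f z (w - P' w)) by rewrite -E dotvv.
  apply: le_trans (ler_norm _) (le_trans (Re_dot_le _ _) _).
  by rewrite mulrC [leRHS]mulrAC ler_wpM2r //; have := near' w; rewrite Pw.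
have -> : P' z - P z = P' z - P (P' z) - w.
  rewrite /w; have := orthoproj_linear sM cM (-1) (P' z) z.
  by rewrite !scaleN1r [- _ + z]addrC -/P => ->; rewrite opprD opprK addrA subrK.
by apply: le_trans (dnormvB _ _) _; have := near z; lra.
Qed.

End InnerProduct.

(** * Square roots and dense extensions of bounded operators *)

Definition linear_of {K : pzRingType} {U W : lmodType K} (A : U -> W) (lA : linear A) :
    {linear U -> W} := HB.pack A (GRing.isLinear.Build _ _ _ _ A lA).

Section SquareRoot.
Context {R : realType} {V : lmodType R[i]}.
Variable f : {dot V for (@Num.conj R[i])}.
Local Notation N := (dnorm f).

Section Iteration.
Variable X : {linear V -> V}.
Hypothesis symX : forall u v, f (X u) v = f u (X v).
Hypothesis contrX : forall u, N (X u) <= N u.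

Fixpoint sqrt_iter n : V -> V := fun u =>
  if n is m.+1 then (2^-1)%:C *: (X u + sqrt_iter m (sqrt_iter m u)) else 0.

Fixpoint sqrt_bound n : R :=
  if n is m.+1 then 2^-1 * (1 + sqrt_bound m ^+ 2) else 0.

Local Notation Y := sqrt_iter.
Local Notation y := sqrt_bound.

Lemma sqrt_bound01 n : 0 <= y n <= 1.
Proof. by elim: n => [|n IH] //=; [rewrite lexx ler01 | nra]. Qed.

Lemma sqrt_bound_nd n : y n <= y n.+1.
Proof. by have := sqrt_bound01 n => /=; nra. Qed.

Lemma sqrt_bound_cvg : exists L, null_seq (fun n => L - y n) /\ forall n, y n <= L.
Proof.
have nd : nondecreasing_seq y by apply/nondecreasing_seqP; exact: sqrt_bound_nd.
have ub : has_ubound (range y) by exists 1 => _ [n _ <-]; case/andP: (sqrt_bound01 n).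
have cy := nondecreasing_is_cvgn nd ub.
exists (limn y); split; last by move=> n; exact: nondecreasing_cvgn_le.
by rewrite /null_seq -[0](subrr (limn y)); apply: cvgB => //; exact: cvg_cst.
Qed.

Lemma sqrt_iter_linear n : linear (Y n).
Proof.
elim: n => [|n IH] a u v /=; first by rewrite scaler0 addr0.
rewrite !IH linearP addrACA -(scalerDr a) [LHS]scalerDr !scalerA.
by rewrite [a * _]mulrC.
Qed.

Lemma sqrt_iterB n u v : Y n (u - v) = Y n u - Y n v.
Proof. exact: (linearB (linear_of (sqrt_iter_linear n))). Qed.

Lemma sqrt_iterD n u v : Y n (u + v) = Y n u + Y n v.
Proof. exact: (linearD (linear_of (sqrt_iter_linear n))). Qed.

Lemma sqrt_iterZ n a u : Y n (a *: u) = a *: Y n u.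
Proof. exact: (linearZZ (linear_of (sqrt_iter_linear n))). Qed.

Lemma sqrt_iter_commX n u : Y n (X u) = X (Y n u).
Proof.
elim: n u => [|n IH] u /=; first by rewrite linear0.
by rewrite !IH linearZZ (linearD X).
Qed.

(** [Y n.+1] is a polynomial in [X] and [Y n], and these commute. *)
Lemma sqrt_iter_comm n u : Y n.+1 (Y n u) = Y n (Y n.+1 u).
Proof. by rewrite /= sqrt_iterZ sqrt_iterD sqrt_iter_commX. Qed.

Lemma sqrt_iter_sym n u v : f (Y n u) v = f u (Y n v).
Proof.
elim: n u v => [|n IH] u v /=; first by rewrite dot0l dot0r.
by rewrite dotZl dotZr dotDl dotDr symX !IH conjc_real.
Qed.

Lemma dnorm_half u : N ((2^-1)%:C *: u) = 2^-1 * N u.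
Proof. by rewrite dnormvZr // invr_ge0. Qed.

Lemma sqrt_iter_le n u : N (Y n u) <= y n * N u.
Proof.
elim: n u => [|n IH] u /=; first by rewrite dnorm0 mul0r.
rewrite dnorm_half -mulrA ler_pM2l ?invr_gt0 //.
apply: le_trans (dnormvD _ _ _) _; rewrite mulrDl mul1r lerD //.
apply: le_trans (IH _) _; rewrite expr2 -mulrA ler_wpM2l //.
by case/andP: (sqrt_bound01 n).
Qed.

(** Consecutive iterates commute, so twice the next increment factors as
    [(Y n.+1 + Y n) (Y n.+1 - Y n)]. The scalar recursion factors in the same way, and the bounds
    match term by term. *)
Lemma sqrt_iter_step n u : N (Y n.+1 u - Y n u) <= (y n.+1 - y n) * N u.
Proof.
elim: n u => [|n IH] u.
  rewrite /= addr0 subr0 expr0n /= addr0 mulr1 subr0 dnorm_half.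
  by rewrite ler_pM2l ?invr_gt0.
have -> : Y n.+2 u - Y n.+1 u =
    (2^-1)%:C *: (Y n.+1 (Y n.+1 u - Y n u) + Y n (Y n.+1 u - Y n u)).
  rewrite !sqrt_iterB sqrt_iter_comm addrA subrK.
  rewrite [Y n.+2 u]/(Y n.+2 u) [in LHS]/sqrt_iter -/sqrt_iter.
  by rewrite -scalerBr opprD addrACA subrr add0r.
rewrite dnorm_half.
have -> : y n.+2 - y n.+1 = 2^-1 * (y n.+1 * (y n.+1 - y n) + y n * (y n.+1 - y n)).
  by rewrite /=; field.
rewrite -mulrA ler_pM2l ?invr_gt0 // mulrDl -(mulrA (y n.+1)) -(mulrA (y n)).
have yp k : 0 <= y k by case/andP: (sqrt_bound01 k).
apply: le_trans (dnormvD _ _ _) (lerD _ _).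
  by apply: le_trans (sqrt_iter_le _ _) _; rewrite ler_wpM2l.
by apply: le_trans (sqrt_iter_le _ _) _; rewrite ler_wpM2l.
Qed.

Lemma sqrt_iter_dist m n u : (n <= m)%N -> N (Y m u - Y n u) <= (y m - y n) * N u.
Proof.
move=> /subnK <-; elim: (m - n)%N => [|k IH]; first by rewrite !subrr dnorm0 mul0r.
apply: le_trans (ddistD f (Y (k + n) u) _ _) _.
by have := sqrt_iter_step (k + n) u; rewrite -addSn; lra.
Qed.

Lemma sqrt_iter_cauchy u : dcauchy f (fun n => Y n u).
Proof.
have [L [L0 yL]] := sqrt_bound_cvg.
exists (fun n => N u * (L - y n)); first exact: null_seqZ.
have Nu := dnormv_ge0 f u.
have nm m n : (n <= m)%N -> N (Y m u - Y n u) <= N u * (L - y m) + N u * (L - y n).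
  move=> mn; apply: le_trans (sqrt_iter_dist u mn) _.
  by have := yL m; have := yL n; nra.
by move=> m n; case: (leqP n m) => [|/ltnW] /nm //; rewrite ddistC [leRHS]addrC.
Qed.

End Iteration.

(* The iteration [Y' = (X + Y^2) / 2] with [X = 1 - A] increases to a fixed
   point [Y], and [C = 1 - Y]; it is dominated in norm by the same iteration
   for the scalar [X = 1]. *)
Lemma sqrt_operator (A : {linear V -> V}) : dcomplete f setT ->
  (forall u v, f (A u) v = f u (A v)) -> (forall u, N (u - A u) <= N u) ->
  exists C : {linear V -> V}, [/\ forall u v, f (C u) v = f u (C v),
    forall u, N (u - C u) <= N u & forall u, C (C u) = A u].
Proof.
move=> cV symA contrA.
have lX : linear (fun u => u - A u).
  by move=> a u v; rewrite linearP scalerBr opprD addrACA.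
pose X := linear_of lX.
have symX u v : f (X u) v = f u (X v) by rewrite /= dotBl dotBr symA.
have contrX u : N (X u) <= N u by exact: contrA.
have /choice[Y YP] u : exists l, dlim f (fun n => sqrt_iter X n u) l.
  by have [l _] := cV _ (fun=> I) (sqrt_iter_cauchy contrX u); exists l.
have lY : linear Y.
  move=> a u v; apply: dlim_unique (YP _) _.
  have := dlimD (dlimZ a (YP u)) (YP v).
  by congr dlim; apply/funext => n; rewrite sqrt_iter_linear.
have leY u : N (Y u) <= N u.
  apply: dlim_norm_le (YP u) _ => n; apply: le_trans (sqrt_iter_le contrX n u) _.
  by rewrite ler_piMl ?dnormv_ge0 //; case/andP: (sqrt_bound01 n).
have symY u v : f (Y u) v = f u (Y v).
  apply/eqP; rewrite -subr_eq0; apply/eqP; apply: eq0_normc; apply/eqP.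
  rewrite eq_le normc_ge0 andbT.
  have := le_null_seq (null_seqD (null_seqZ (N v) (YP u)) (null_seqZ (N u) (YP v))).
  apply => n; rewrite add0r.
  have -> : f (Y u) v - f u (Y v) =
      f u (sqrt_iter X n v - Y v) - f (sqrt_iter X n u - Y u) v.
    by rewrite dotBl dotBr (sqrt_iter_sym symX); ring.
  apply: le_trans (le_normcD _ _) _; rewrite normcN addrC mulrC.
  by apply: lerD; exact: dot_cauchy_schwarz.
(* The limit of the recursion is [2 Y = X + Y Y]. For [C = 1 - Y] this says [C C = 1 - X = A]. *)
have fixY u : X u = Y u *+ 2 - Y (Y u).
  have lim1 : dlim f (fun n => sqrt_iter X n (sqrt_iter X n u)) (Y (Y u)).
    apply: dlim_le (null_seqD (YP u) (YP (Y u))) _ => n.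
    apply: le_trans (ddistD f (sqrt_iter X n (Y u)) _ _) _.
    rewrite lerD2r -sqrt_iterB; apply: le_trans (sqrt_iter_le contrX n _) _.
    by rewrite ler_piMl ?dnormv_ge0 //; case/andP: (sqrt_bound01 n).
  have lim2 : dlim f (fun n => sqrt_iter X n.+1 u) (Y u).
    by have := YP u; rewrite /dlim /null_seq -(cvg_shiftS (fun n => N (sqrt_iter X n u - Y u))).
  have limX : dlim f (fun=> X u) (X u).
    apply: dlim_le (@null_seqZ _ 0 _ (@null_seq_harmonic R)) _ => n.
    by rewrite subrr dnorm0 mul0r.
  have Yu := dlim_unique lim2 (dlimZ (2^-1)%:C (dlimD limX lim1)).
  rewrite {1}Yu -scaler_nat scalerA -(rmorph_nat (real_complex R) 2) -rmorphM.
  by rewrite mulfV // scale1r addrK.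
have lC : linear (fun u => u - Y u).
  by move=> a u v; rewrite lY scalerBr opprD addrACA.
exists (linear_of lC); split=> [u v|u|u] /=.
- by rewrite dotBl dotBr symY.
- by rewrite opprB addrC subrK.
- have -> : Y (u - Y u) = Y u - Y (Y u) by exact: (linearB (linear_of lY)).
  have -> : A u = u - X u by rewrite /= opprB addrC subrK.
  by rewrite fixY mulr2n !opprD opprK !addrA.
Qed.

End SquareRoot.

(** * Closures of ranges *)

Section RangeClosure.
Context {R : realType} {U V : lmodType R[i]}.
Variable f : {dot V for (@Num.conj R[i])}.

Lemma dlim_cst l : dlim f (fun=> l) l.
Proof.
apply: dlim_le (@null_seq_harmonic R) _ => n.
by rewrite subrr dnorm0 invr_ge0.
Qed.

(** The approximating sequence is taken in the source [U], so that it can also be fed to another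
    operator on [U]. *)
Definition range_closure (C : U -> V) := [set p | exists y : nat -> U, dlim f (C \o y) p].

Variable C : {linear U -> V}.
Local Notation K := (range_closure C).

Lemma range_closure_subspace : linear_subspace K.
Proof.
split.
  exists (fun=> 0); apply: dlim_le (@null_seq_harmonic R) _ => n /=.
  by rewrite linear0 subrr dnorm0 invr_ge0.
move=> a u v [y yu] [z zv]; exists (fun n => a *: y n + z n).
have := dlimD (dlimZ a yu) zv.
by congr dlim; apply/funext => n /=; rewrite linearP.
Qed.

Lemma range_closure_complete : dcomplete f setT -> dcomplete f K.
Proof.
move=> cV; apply: seq_closed_complete => // s l sK sl.
have /choice[y yP] n : exists y, dnorm f (C y - s n) < n.+1%:R^-1.
  have [z /(@null_seq_lt _ _ n.+1%:R^-1)] := sK n.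
  rewrite invr_gt0 ltr0Sn => /(_ isT)[k /(_ k (leqnn k))].
  by rewrite ger0_norm ?dnormv_ge0 //; exists (z k).
exists y; apply: dlim_le (null_seqD (@null_seq_harmonic R) sl) _ => n /=.
by apply: le_trans (ddistD f (s n) _ _) _; rewrite lerD2r (ltW (yP n)).
Qed.

Lemma range_closure_in y : K (C y).
Proof. by exists (fun=> y); exact: dlim_cst. Qed.

End RangeClosure.

(** * Extension of a bounded map from the range of an operator *)

Section DenseExtension.
Context {R : realType} {U V V' : lmodType R[i]}.
Variables (f : {dot V for (@Num.conj R[i])}) (f' : {dot V' for (@Num.conj R[i])}).
Hypothesis (cV : dcomplete f setT) (cV' : dcomplete f' setT).
Variables (C : {linear U -> V}) (F : {linear U -> V'}).
Hypothesis FC : forall y, dnorm f' (F y) <= dnorm f (C y).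

(** The closure of the graph of the correspondence from [C y] to [F y]; [FC] makes it single-valued
    and contractive. *)
Let rel p w := exists y : nat -> U, dlim f (C \o y) p /\ dlim f' (F \o y) w.

Let rel_linear a p q v w : rel p v -> rel q w -> rel (a *: p + q) (a *: v + w).
Proof.
move=> [y [yp yv]] [z [zq zw]]; exists (fun n => a *: y n + z n); split.
  have := dlimD (dlimZ a yp) zq.
  by congr dlim; apply/funext => n /=; rewrite linearP.
have := dlimD (dlimZ a yv) zw.
by congr dlim; apply/funext => n /=; rewrite linearP.
Qed.

Let rel_le p w : rel p w -> dnorm f' w <= dnorm f p.
Proof.
move=> [y [yp yw]]; apply: (le_null_seq (null_seqD yp yw)) => n /=.
rewrite addrA (ddistC f' (F _)).
apply: le_trans (dnormv_leD f' _ (F (y n))) _; rewrite lerD2r.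
exact: le_trans (FC _) (dnormv_leD f _ _).
Qed.

Let rel_unique p v w : rel p v -> rel p w -> v = w.
Proof.
move=> pv pw; have := rel_le (rel_linear (-1) pv pw).
rewrite !scaleN1r addNr dnorm0 => vw; apply/esym/eqP.
by rewrite -subr_eq0 addrC -(dnormv_eq0 f') eq_le vw dnormv_ge0.
Qed.

Local Notation K := (range_closure f C).

Let rel_exists p : K p -> exists w, rel p w.
Proof.
move=> [y yp]; have [r r0 ry] := dlim_cauchy yp.
have : dcauchy f' (F \o y).
  exists r => // m n; apply: le_trans (ry m n).
  by rewrite /= -(linearB F) -(linearB C).
by move=> /(cV' (fun=> I))[w _ yw]; exists w, y.
Qed.

Let sK := range_closure_subspace f C.
Let cK := range_closure_complete (C := C) cV.

(** By [FC] the assignment of [F y] to [C y] extends to the closed range of [C] by limits.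
    Precomposing with the projection extends it by zero to the whole space. *)
Lemma dense_extension : exists W : {linear V -> V'},
  (forall z, dnorm f' (W z) <= dnorm f z) /\ forall y, W (C y) = F y.
Proof.
have /choice[W WP] z : exists w, rel (orthoproj f K z) w.
  by apply: rel_exists; exact: orthoproj_in sK cK z.
have lW : linear W.
  move=> a u v; apply: (rel_unique (WP _)).
  by rewrite (orthoproj_linear sK cK); exact: rel_linear.
exists (linear_of lW); split=> [z|y] /=.
  by apply: le_trans (rel_le (WP z)) _; exact: orthoproj_le.
apply: (rel_unique (WP _)); rewrite orthoproj_id //; last exact: range_closure_in.
by exists (fun=> y); split; exact: dlim_cst.
Qed.

End DenseExtension.

(** * Hilbert spaces and their products *)

Section HilbertSpace.
Context {R : realType} {H : hilbertType R}.
Local Notation N := (dnorm (@hdot R H)).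

(** The library norm takes values in [R[i]]. This identity carries library topology and completeness
    over to the real-valued [dnorm]. *)
Lemma hilbert_normE (x : H) : `|x| = (N x)%:C.
Proof.
apply/eqP; rewrite -(@eqrXn2 _ 2) ?normr_ge0 ?ler0c ?dnormv_ge0 //.
by rewrite hdot_norm dotvv rmorphXn.
Qed.

Lemma hilbert_dlim (s : nat -> H) l : dlim hdot s l <-> s @ \oo --> l.
Proof.
split=> [sl|/cvgrPdist_lt sl].
  apply/cvgrPdist_lt => e e0.
  (* A positive element of [R[i]] is real. *)
  have [ImE Re0] : complex.Im e = 0 /\ 0 < complex.Re e.
    by move: e0; rewrite ltcE /= => /andP[/eqP].
  have [M MP] := null_seq_lt sl Re0.
  exists M => // n /MP; rewrite ger0_norm ?dnormv_ge0 // => sn.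
  by rewrite distrC hilbert_normE ltcE /= ImE eqxx.
apply/cvgrPdist_lt => e e0.
have e0' : 0 < e%:C :> R[i] by rewrite ltcR.
have [M _ MP] := sl _ e0'.
exists M => // n /MP; rewrite /= distrC hilbert_normE ltcR sub0r normrN => sn.
by rewrite ger0_norm ?dnormv_ge0.
Qed.

Lemma hilbert_complete : dcomplete (@hdot R H) setT.
Proof.
move=> s _ [r r0 rs].
have : cauchy (s @ \oo).
  apply/cauchy_ballP => e e0.
  have [ImE Re0] : complex.Im e = 0 /\ 0 < complex.Re e.
    by move: e0; rewrite ltcE /= => /andP[/eqP].
  have [M MP] := null_seq_lt r0 (ltac:(by rewrite divr_gt0) : 0 < complex.Re e / 2).
  exists (s @` [set n | (M <= n)%N], s @` [set n | (M <= n)%N]) => /=.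
    by split; exists M => // n Mn; exists n.
  move=> [_ _] /= [[m Mm <-] [n Mn <-]].
  rewrite -ball_normE /ball_ /= hilbert_normE ltcE /= ImE eqxx /=.
  apply: le_lt_trans (rs m n) _.
  have := MP m Mm; have := MP n Mn; have := ler_norm (r m); have := ler_norm (r n).
  lra.
move=> /cauchy_cvg/cvg_ex[l sl]; exists l => //; exact/hilbert_dlim.
Qed.

Lemma seq_closed_closed (A : set H) : seq_closed hdot A -> closed A.
Proof.
move=> cA p Ap.
have /choice[s sP] n : exists a, A a /\ N (a - p) <= n.+1%:R^-1.
  have e0 : 0 < (n.+1%:R^-1 : R)%:C :> R[i] by rewrite ltcR invr_gt0.
  have [a [Aa]] := Ap _ (nbhsx_ballx p _ e0).
  rewrite -ball_normE /ball_ /= hilbert_normE ltcR ddistC => /ltW pa.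
  by exists a.
apply: (cA s) => [n|]; first exact: (sP n).1.
by apply: dlim_le (@null_seq_harmonic R) _ => n; exact: (sP n).2.
Qed.

End HilbertSpace.

Section ProductSpace.
Context {R : realType} {H1 H2 : hilbertType R}.
Local Notation N1 := (dnorm (@hdot R H1)).
Local Notation N2 := (dnorm (@hdot R H2)).
Local Notation Z := (H1 * H2)%type.
Local Notation pdot := (@prod_dot R H1 H2).
Local Notation N := (dnorm pdot).

Lemma prod_dot0l (y : H2) (z : Z) : pdot (0, y) z = hdot y z.2.
Proof.
have -> : pdot (0, y) z = hdot (0 : H1) z.1 + hdot y z.2 by [].
by rewrite dot0l add0r.
Qed.

Lemma prod_dot0r (x : H1) (z : Z) : pdot (x, 0) z = hdot x z.1.
Proof.
have -> : pdot (x, 0) z = hdot x z.1 + hdot (0 : H2) z.2 by [].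
by rewrite dot0l addr0.
Qed.

Lemma prod_dnorm_sqr (z : Z) : N z ^+ 2 = N1 z.1 ^+ 2 + N2 z.2 ^+ 2.
Proof. by apply: complexI; rewrite [RHS]rmorphD /= -!dotvv. Qed.

Lemma dnorm_fst_le (z : Z) : N1 z.1 <= N z.
Proof.
by rewrite -(@ler_pXn2r _ 2) ?nnegrE ?dnormv_ge0 // prod_dnorm_sqr lerDl sqr_ge0.
Qed.

Lemma dnorm_snd_le (z : Z) : N2 z.2 <= N z.
Proof.
by rewrite -(@ler_pXn2r _ 2) ?nnegrE ?dnormv_ge0 // prod_dnorm_sqr lerDr sqr_ge0.
Qed.

Lemma prod_dnorm_le (z : Z) : N z <= N1 z.1 + N2 z.2.
Proof.
have := dnormv_ge0 hdot z.1; have := dnormv_ge0 hdot z.2 => z1 z2.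
rewrite -(@ler_pXn2r _ 2) ?nnegrE ?addr_ge0 ?dnormv_ge0 // prod_dnorm_sqr sqrrD.
by rewrite addrAC lerDl mulrn_wge0 // mulr_ge0.
Qed.

Lemma prod_dnorm0r (y : H2) : N (0, y) = N2 y.
Proof.
apply/eqP; rewrite -(@eqrXn2 _ 2) ?dnormv_ge0 // prod_dnorm_sqr /=.
by rewrite dnorm0 expr0n /= add0r.
Qed.

Lemma dlim_fst (s : nat -> Z) l : dlim pdot s l -> dlim hdot (fun n => (s n).1) l.1.
Proof. by move=> sl; apply: dlim_le sl _ => n; exact: dnorm_fst_le (s n - l). Qed.

Lemma dlim_snd (s : nat -> Z) l : dlim pdot s l -> dlim hdot (fun n => (s n).2) l.2.
Proof. by move=> sl; apply: dlim_le sl _ => n; exact: dnorm_snd_le (s n - l). Qed.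

Lemma dlim_pair (s : nat -> H1) (t : nat -> H2) l m :
  dlim hdot s l -> dlim hdot t m -> dlim pdot (fun n => (s n, t n)) (l, m).
Proof.
move=> sl tm; apply: dlim_le (null_seqD sl tm) _ => n.
exact: prod_dnorm_le ((s n, t n) - (l, m)).
Qed.

Lemma prod_complete : dcomplete pdot setT.
Proof.
move=> s _ [r r0 rs].
have [|l1 _ sl1] := @hilbert_complete R H1 (fun n => (s n).1) (fun=> I).
  by exists r => // m n; apply: le_trans (dnorm_fst_le (s m - s n)) (rs m n).
have [|l2 _ sl2] := @hilbert_complete R H2 (fun n => (s n).2) (fun=> I).
  by exists r => // m n; apply: le_trans (dnorm_snd_le (s m - s n)) (rs m n).
exists (l1, l2) => //.
apply: dlim_le (null_seqD sl1 sl2) _ => n.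
exact: prod_dnorm_le (s n - (l1, l2)).
Qed.

Lemma prod_closed_seq_closed (A : set Z) : closed A -> seq_closed pdot A.
Proof.
move=> cA s l sA sl.
apply: (closed_cvg A cA (F := \oo) (u_ := s)); first exact: nearW.
have c1 := (hilbert_dlim _ _).1 (dlim_fst sl).
have c2 := (hilbert_dlim _ _).1 (dlim_snd sl).
have -> : s = (fun n => ((s n).1, (s n).2)) by apply/funext => n; case: (s n).
by rewrite (surjective_pairing l); exact: cvg_pair c1 c2.
Qed.

Lemma prod_seq_closed_closed (A : set Z) : seq_closed pdot A -> closed A.
Proof.
move=> cA p Ap.
(* A ball of the product is a product of balls, and the Hilbert norm is at most the sum of the
   coordinate norms: hence the factor 2. *)
have /choice[s sP] n : exists a, A a /\ N (a - p) <= 2 * n.+1%:R^-1.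
  have e0 : 0 < (n.+1%:R^-1 : R)%:C :> R[i] by rewrite ltcR invr_gt0.
  have [a [Aa]] := Ap _ (nbhsx_ballx p _ e0).
  move=> [/=]; rewrite -!ball_normE /ball_ /= !hilbert_normE !ltcR => a1 a2.
  exists a; split=> //; apply: le_trans (prod_dnorm_le (a - p)) _ => /=.
  by rewrite (ddistC hdot a.1) (ddistC hdot a.2) mulr_natl lerD // ltW.
apply: (cA s) => [n|]; first exact: (sP n).1.
by apply: dlim_le (null_seqZ 2 (@null_seq_harmonic R)) _ => n; exact: (sP n).2.
Qed.

Lemma opnorm_le (A : Z -> Z) (c : R) : 0 <= c ->
  (forall z, N (A z) <= c * N z) -> (opnorm pdot A <= c%:E)%E.
Proof.
move=> c0 Ac; apply: ge_ereal_sup => _ [z /= z1 <-]; rewrite lee_fin.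
by apply: le_trans (Ac z) _; rewrite ler_piMr.
Qed.

End ProductSpace.

(** * Closed operators and their perturbations *)

Section Operators.
Context {R : realType} {H1 H2 : hilbertType R}.
Local Notation N1 := (dnorm (@hdot R H1)).
Local Notation N2 := (dnorm (@hdot R H2)).
Local Notation Z := (H1 * H2)%type.
Local Notation pdot := (@prod_dot R H1 H2).
Local Notation N := (dnorm pdot).
Implicit Types S T : cdop H1 H2.

Lemma domP T : linear_subspace (dom T).
Proof. by split; [exact: dom0 | exact: dom_linear]. Qed.

Lemma opD T x y : dom T x -> dom T y -> T (x + y) = T x + T y.
Proof. by move=> Tx Ty; have := op_linear 1 Tx Ty; rewrite !scale1r. Qed.

Lemma op0 T : T 0 = 0.
Proof.
have := op_linear (-1) (dom0 T) (dom0 T).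
by rewrite scaler0 addr0 scaleN1r addNr.
Qed.

Lemma opZ T a x : dom T x -> T (a *: x) = a *: T x.
Proof. by move=> Tx; have := op_linear a Tx (dom0 T); rewrite op0 !addr0. Qed.

Lemma opB T x y : dom T x -> dom T y -> T (x - y) = T x - T y.
Proof. by move=> Tx Ty; rewrite addrC -scaleN1r op_linear // scaleN1r addrC. Qed.

Lemma graph_subspace T : linear_subspace (Defs.graph T).
Proof.
split; first by split; [exact: dom0 | rewrite op0].
move=> a [x y] [x' y'] [/= Tx ->] [/= Tx' ->]; split=> /=; first exact: dom_linear.
by rewrite op_linear.
Qed.

Lemma graph_seq_closed T : seq_closed pdot (Defs.graph T).
Proof. apply: prod_closed_seq_closed; exact: graph_closed. Qed.

Lemma graph_complete T : dcomplete pdot (Defs.graph T).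
Proof. exact: seq_closed_complete prod_complete (@graph_seq_closed T). Qed.

Lemma null_space_subspace T : linear_subspace (null_space T).
Proof.
split; first by split; [exact: dom0 | rewrite op0].
move=> a x y [Tx Tx0] [Ty Ty0]; split; first exact: dom_linear.
by rewrite op_linear // Tx0 Ty0 scaler0 addr0.
Qed.

Lemma null_space_complete T : dcomplete hdot (null_space T).
Proof.
apply: seq_closed_complete hilbert_complete _ => s l sT sl.
have [|/= Tl T0] := @graph_seq_closed T (fun n => (s n, 0)) (l, 0) _ (dlim_pair sl (dlim_cst _ _)).
  by move=> n; have [Ts Ts0] := sT n.
by split.
Qed.

Lemma carrier_subspace T : linear_subspace (carrier T).
Proof.
split; first by split; [exact: dom0 | move=> y _; exact: dot0l].
move=> a x y [Tx xN] [Ty yN]; split; first exact: dom_linear.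
by move=> n Tn; rewrite dotDl dotZl xN // yN // mulr0 addr0.
Qed.

Lemma carrier_graph_subspace T : linear_subspace (carrier_graph T).
Proof.
split; first by split; [exact: (carrier_subspace T).1 | rewrite op0].
move=> a [x y] [x' y'] [/= Tx ->] [/= Tx' ->]; split=> /=.
  exact: (carrier_subspace T).2.
by rewrite op_linear //; [case: Tx | case: Tx'].
Qed.

Lemma carrier_graph_seq_closed T : seq_closed pdot (carrier_graph T).
Proof.
move=> s l sT sl.
have [|Tl lT] := @graph_seq_closed T s l _ sl.
  by move=> n; have [[]] := sT n.
split=> //; split=> // y Ty; apply: dlim_dot0 (dlim_fst sl) _ => n.
by have [[_ ->]] := sT n.
Qed.

Lemma carrier_graph_complete T : dcomplete pdot (carrier_graph T).
Proof. exact: seq_closed_complete prod_complete (@carrier_graph_seq_closed T). Qed.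

Lemma carrier_graph_in T x : carrier T x -> carrier_graph T (x, T x).
Proof. by []. Qed.

(** The projection of [x] on the null space lies in the domain, hence so does the remainder. In
    particular [T] takes all its values on the carrier. *)
Lemma carrier_decomposition T x : dom T x ->
  exists n c, [/\ null_space T n, carrier T c, x = n + c & T x = T c].
Proof.
move=> Tx; set n := orthoproj hdot (null_space T) x.
have sN := null_space_subspace T; have cN := @null_space_complete T.
have Tn : null_space T n by exact: orthoproj_in.
have Tc : dom T (x - n) by exact: (subspaceB (domP T) Tx Tn.1).
exists n, (x - n); split=> //.
- by split=> // y; exact: orthoproj_orth.
- by rewrite addrC subrK.
- by rewrite opB //; [rewrite Tn.2 subr0 | case: Tn].
Qed.

Lemma carrier_null_eq0 T x : carrier T x -> T x = 0 -> x = 0.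
Proof.
move=> [Tx xN] Tx0; apply/eqP; rewrite -(dnorm_eq0 hdot); apply/eqP/xN.
by split.
Qed.

Definition bounded_below T :=
  exists2 c : R, 0 < c & forall x, carrier T x -> c * N1 x <= N2 (T x).

(** Preimages chosen in the carrier inherit the Cauchy property from their images, and closedness of
    the graph identifies the limit. *)
Lemma bounded_below_closed_range T : bounded_below T -> closed_range T.
Proof.
move=> [c c0 cT]; apply: seq_closed_closed => s l sT sl.
have /choice[x xP] n : exists x, carrier T x /\ T x = s n.
  have [y Ty <-] := sT n; have [_ [d [_ Td _ ->]]] := carrier_decomposition Ty.
  by exists d.
have [r r0 rs] := dlim_cauchy sl.
have cx : dcauchy hdot x.
  exists (fun n => c^-1 * r n); first exact: null_seqZ.
  move=> m n; rewrite -mulrDr -(ler_pM2l c0) mulVKf ?gt_eqF //.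
  apply: le_trans (rs m n).
  have [Tm <-] := xP m; have [Tn <-] := xP n.
  rewrite -opB; [|by case: Tm|by case: Tn].
  by apply: cT; exact: subspaceB (carrier_subspace T) _ _ _ _.
have [y _ xy] := hilbert_complete (fun=> I) cx.
have [|/= Ty lE] := @graph_seq_closed T (fun n => (x n, s n)) (y, l) _ (dlim_pair xy sl).
  by move=> n; have [[Tx _] E] := xP n.
by exists y.
Qed.

Lemma attaining_intro T x : carrier T x -> N1 x = 1 ->
  (forall y, carrier T y -> N1 y = 1 -> N2 (T x) <= N2 (T y)) ->
  reduced_min_attaining T.
Proof.
move=> Tx x1 xmin; exists x; split=> //; apply/eqP; rewrite eq_le; apply/andP; split.
  by apply: le_ereal_inf_tmp => _ [y [Ty y1] <-]; rewrite lee_fin xmin.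
by apply: ereal_inf_lbound; exists x.
Qed.

(** A pointwise, real-valued form of the bound [e] on the gap, convenient for the triangle
    inequality; [carrier_near] is its counterpart for carrier graphs. *)
Definition graph_near (e : R) S T := forall z : Z,
  N (orthoproj pdot (Defs.graph S) z - orthoproj pdot (Defs.graph T) z) <= e * N z.

Definition carrier_near (e : R) S T := forall z : Z,
  N (orthoproj pdot (carrier_graph S) z - orthoproj pdot (carrier_graph T) z) <= e * N z.

Lemma graph_near_trans e e' S T U :
  graph_near e S T -> graph_near e' T U -> graph_near (e + e') S U.
Proof.
move=> ST TU z; rewrite mulrDl; apply: le_trans (ddistD _ _ _ _) (lerD (ST z) (TU z)).
Qed.

Lemma carrier_near_trans e e' S T U :
  carrier_near e S T -> carrier_near e' T U -> carrier_near (e + e') S U.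
Proof.
move=> ST TU z; rewrite mulrDl; apply: le_trans (ddistD _ _ _ _) (lerD (ST z) (TU z)).
Qed.

Lemma gap_metric_lt e e' S T : 0 <= e < e' -> graph_near e S T ->
  (gap_metric S T < e'%:E)%E.
Proof.
by move=> /andP[e0 ee'] ST; apply: le_lt_trans (opnorm_le e0 ST) _; rewrite lte_fin.
Qed.

Lemma carrier_graph_metric_lt e e' S T : 0 <= e < e' -> carrier_near e S T ->
  (carrier_graph_metric S T < e'%:E)%E.
Proof.
by move=> /andP[e0 ee'] ST; apply: le_lt_trans (opnorm_le e0 ST) _; rewrite lte_fin.
Qed.

(** * Perturbation by a small operator on the product space *)

Section Perturbation.
Variables (T : cdop H1 H2) (B : {linear Z -> H2}) (d : R).
Hypothesis d01 : 0 <= d <= 2^-1.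
Hypothesis Bd : forall z, N2 (B z) <= d * N z.

(** The graph of the perturbed operator is the image of the graph of [T] under this map, which
    differs from the identity by at most [d] in norm. *)
Let shear (z : Z) : Z := (z.1, z.2 + B z).

Let shear_dist z : N (shear z - z) <= d * N z.
Proof.
have -> : shear z - z = (0, B z).
  by case: z => x y; congr pair; rewrite /= ?subrr // addrC addKr.
by rewrite prod_dnorm0r.
Qed.

(** Here [d <= 1/2] enters: [|z| <= |shear z| + d |z|]. *)
Let shear_le z : N z <= 2 * N (shear z).
Proof.
have := shear_dist z; rewrite ddistC => zS; have := dnormv_leD pdot z (shear z).
case/andP: d01 => _ d2; have := dnormv_ge0 pdot z; nra.
Qed.

Let op (x : H1) : H2 := T x + B (x, T x).

Let op_lin a x y : dom T x -> dom T y -> op (a *: x + y) = a *: op x + op y.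
Proof.
move=> Tx Ty; rewrite /op op_linear // scalerDr addrACA; congr (_ + _).
by have := linearP B a (x, T x) (y, T y).
Qed.

(** A convergent sequence in the sheared graph pulls back to a Cauchy sequence in the graph of [T],
    because the shear is bounded below. *)
Let op_closed : closed [set z : Z | dom T z.1 /\ z.2 = op z.1].
Proof.
apply: prod_seq_closed_closed => s l sT sl.
pose t n : Z := ((s n).1, T (s n).1).
have tG n : Defs.graph T (t n) by have [] := sT n.
have sE n : s n = shear (t n) by have [_] := sT n; rewrite /shear /t /op; case: (s n) => x y /= ->.
have ct : dcauchy pdot t.
  have [r r0 rs] := dlim_cauchy sl; exists (fun n => 2 * r n); first exact: null_seqZ.
  move=> m n; apply: le_trans (shear_le _) _; rewrite -mulrDr ler_pM2l //.
  apply: le_trans (rs m n); rewrite !sE /shear /=.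
  have -> : B (t m - t n) = B (t m) - B (t n) by exact: linearB.
  by rewrite (addrACA (T _)) -opprD.
have [u [Tu uT] tu] := graph_complete tG ct.
have lE : l = shear u.
  apply: dlim_unique sl _; apply: dlim_le (null_seqZ 2 tu) _ => n.
  rewrite sE.
  have -> : shear (t n) - shear u = shear (t n - u).
    rewrite /shear; congr pair => /=.
    have -> : B (t n - u) = B (t n) - B u by exact: linearB.
    by rewrite (addrACA (t n).2) -opprD.
  apply: le_trans (dnormv_leD pdot _ (t n - u)) _.
  have := shear_dist (t n - u); case/andP: d01 => _ d2.
  have := dnormv_ge0 pdot (t n - u); nra.
rewrite lE /=; split=> //; rewrite /op -uT.
by case: (u).
Qed.

Definition perturbation : cdop H1 H2 :=
  CDOp (dom0 T) (@dom_linear _ _ _ T) op_lin (@dom_dense _ _ _ T) op_closed.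

Local Notation S := perturbation.

Lemma perturbationE x : S x = T x + B (x, T x). Proof. by []. Qed.

Let shear_near (M : set Z) z : M z ->
  exists2 z', [set shear z | z in M] z' & N (z - z') <= 2 * d * N z.
Proof.
move=> Mz; exists (shear z); first by exists z.
rewrite ddistC; apply: le_trans (shear_dist z) _.
by have := dnormv_ge0 pdot z; case/andP: d01 => d0 _; nra.
Qed.

Let shear_near' (M : set Z) z' : [set shear z | z in M] z' ->
  exists2 z, M z & N (z' - z) <= 2 * d * N z'.
Proof.
move=> [z Mz <-]; exists z => //; apply: le_trans (shear_dist z) _.
by have := shear_le z; case/andP: d01 => d0 _; nra.
Qed.

(** One factor 2 comes from measuring distances relative to [shear z] instead of [z], the other from
    [orthoproj_gap_le]. *)
Let d4 : 2 * (2 * d) = 4 * d. Proof. ring. Qed.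
Let d2_ge0 : 0 <= 2 * d. Proof. by rewrite mulr_ge0 //; case/andP: d01. Qed.

Lemma perturbation_graph_near : graph_near (4 * d) S T.
Proof.
have SE : Defs.graph S = [set shear z | z in Defs.graph T].
  apply/seteqP; split=> [[x y] [/= Tx ->]|_ [[x y] [/= Tx ->] <-]] //.
  by exists (x, T x).
move=> z; rewrite -d4; apply: orthoproj_gap_le => //.
- exact: graph_subspace.
- exact: graph_complete.
- exact: graph_subspace.
- exact: graph_complete.
- by rewrite SE; exact: shear_near.
- by rewrite SE; exact: shear_near'.
Qed.

Hypothesis B0 : forall x, null_space T x -> B (x, 0) = 0.
Variable c : R.
Hypothesis c0 : 0 < c.
Hypothesis cS : forall x, carrier T x -> c * N1 x <= N2 (S x).

(** [B0] makes [S] vanish on the null space of [T]. Conversely, if [S x = 0], then [S] kills the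
    carrier component of [x], which is zero by [cS]. *)
Lemma perturbation_null_space : null_space S = null_space T.
Proof.
apply/seteqP; split=> x [Tx xN]; last first.
  by split=> //; rewrite perturbationE xN add0r B0.
have [n [y [Tn Ty xE TxE]]] := @carrier_decomposition T x Tx.
have Sn : S n = 0 by rewrite perturbationE Tn.2 add0r B0.
have Sy : S y = 0.
  have : S x = 0 by [].
  by rewrite {1}xE opD ?Sn ?add0r //; [case: Tn | case: Ty].
have y0 : y = 0.
  apply/eqP; rewrite -(dnormv_eq0 hdot) eq_le dnormv_ge0 andbT.
  by rewrite -(pmulr_rle0 _ c0) (le_trans (cS Ty)) // Sy dnorm0.
by rewrite xE y0 addr0.
Qed.

Lemma perturbation_carrier : carrier S = carrier T.
Proof. by rewrite /carrier perturbation_null_space. Qed.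

Lemma perturbation_bounded_below : bounded_below S.
Proof. by exists c => // x; rewrite perturbation_carrier; exact: cS. Qed.

Lemma perturbation_carrier_near : carrier_near (4 * d) S T.
Proof.
have SE : carrier_graph S = [set shear z | z in carrier_graph T].
  rewrite /carrier_graph perturbation_carrier.
  apply/seteqP; split=> [[x y] [/= Tx ->]|_ [[x y] [/= Tx ->] <-]] //.
  by exists (x, T x).
move=> z; rewrite -d4; apply: orthoproj_gap_le => //.
- exact: carrier_graph_subspace.
- exact: carrier_graph_complete.
- exact: carrier_graph_subspace.
- exact: carrier_graph_complete.
- by rewrite SE; exact: shear_near.
- by rewrite SE; exact: shear_near'.
Qed.

Lemma perturbation_nonzero : nonzero_op T -> nonzero_op S.
Proof.
move=> [x Tx Tx0]; exists x => //; apply: contra_neq Tx0 => Sx0.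
have : null_space S x by split.
by rewrite perturbation_null_space => -[].
Qed.

End Perturbation.

End Operators.

(** * Approximation *)

Section Approximation.
Context {R : realType} {H1 H2 : hilbertType R}.
Local Notation N1 := (dnorm (@hdot R H1)).
Local Notation N2 := (dnorm (@hdot R H2)).
Local Notation Z := (H1 * H2)%type.
Local Notation pdot := [the {dot (H1 * H2)%type for (@Num.conj R[i])} of @prod_dot R H1 H2].
Local Notation N := (dnorm pdot).
Implicit Types S T : cdop H1 H2.

(** [d <= 1/2] is what [perturbation] requires, and [4 * d] is the resulting bound on both gaps. *)
Lemma small_scale (e : R) : 0 < e -> exists d, [/\ 0 < d, d <= 2^-1 & 4 * d <= e].
Proof.
move=> e0; have [e2|e2] := lerP e 2; [exists (e / 4) | exists 2^-1]; split; lra.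
Qed.

(** * Polar decomposition of the second projection of the carrier graph *)

Section PolarPart.
Variable T : cdop H1 H2.
Local Notation M := (carrier_graph T).
Local Notation P := (orthoproj pdot M).

Let sM := carrier_graph_subspace T.
Let cM := @carrier_graph_complete _ _ _ T.
Let lP := orthoproj_linear sM cM.

Let F_linear : linear (fun z : Z => (P z).2).
Proof. by move=> a u v; rewrite lP. Qed.
Let F : {linear Z -> H2} := linear_of F_linear.

(** This operator is the adjoint of [F] composed with [F], since the adjoint sends [y] to
    [P (0, y)]. *)
Let A_linear : linear (fun z : Z => P (0, F z)).
Proof.
move=> a u v; rewrite -lP; congr orthoproj.
by rewrite linearP; congr pair; rewrite /= scaler0 addr0.
Qed.
Let A : {linear Z -> Z} := linear_of A_linear.

Let dotA z y : pdot (A z) y = hdot (F z) (F y).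
Proof. by rewrite /= orthoproj_sym //; exact: prod_dot0l. Qed.

Let A_sym z y : pdot (A z) y = pdot z (A y).
Proof. by rewrite dotA [RHS]dotC dotA -dotC. Qed.

(** [|z - A z|^2 = |z|^2 + |A z|^2 - 2 |F z|^2], and [|A z| <= |F z|]. *)
Let A_contr z : N (z - A z) <= N z.
Proof.
rewrite -(@ler_pXn2r _ 2) ?nnegrE ?dnormv_ge0 // dnormvB_sqr dotC dotA dotvv.
have : N (A z) <= N2 (F z) by rewrite -(prod_dnorm0r (H1 := H1)); exact: orthoproj_le.
by rewrite /=; have := dnormv_ge0 pdot (A z); nra.
Qed.

(** If [q] in [M] is orthogonal to the range of [A], then [|F q|^2], the product of [A q] and [q],
    is zero. So the second coordinate of [q] vanishes, and injectivity of [T] on its carrier gives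
    [q = 0]. *)
Let range_dense z : M z -> exists y : nat -> Z, dlim pdot (A \o y) z.
Proof.
move=> Mz; set K := range_closure pdot A.
have sK := range_closure_subspace pdot A.
have cK : dcomplete pdot K by exact: range_closure_complete prod_complete.
set q := z - orthoproj pdot K z.
have KM p : K p -> M p.
  move=> [y yp]; apply: (@carrier_graph_seq_closed _ _ _ T _ _ _ yp) => n.
  exact: orthoproj_in.
have Mq : M q by apply: (subspaceB sM Mz); apply: KM; exact: orthoproj_in.
have q2 : q.2 = 0.
  have Pq : P q = q by exact: orthoproj_id.
  have := orthoproj_orth sK cK z (range_closure_in pdot A q); rewrite -/q.
  move=> /dot_eq0C; rewrite dotA /= Pq => /eqP; rewrite dnorm_eq0 => /eqP //.
have q1 : q.1 = 0.
  have [Tq qT] := Mq; exact: carrier_null_eq0 Tq (etrans (esym qT) q2).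
have /eqP : q = 0 by rewrite (surjective_pairing q) q1 q2.
rewrite subr_eq0 => /eqP zK; rewrite -/(K z) zK; exact: orthoproj_in sK cK z.
Qed.

(* [W] is the partial isometry of the polar decomposition of [F], the second
   coordinate on the carrier graph, and [C] is its modulus:
   [F = W C] gives [F A y + d W A y = F (C + d) C y], of norm
   [|C (C + d) C y| = |(C + d) A y| >= d |A y|]. *)
Lemma polar_part (d : R) : 0 <= d <= 1 -> exists B : {linear Z -> H2},
  [/\ forall z, N2 (B z) <= d * N z,
      forall x, null_space T x -> B (x, 0) = 0 &
      forall x, carrier T x -> d * N1 x <= N2 (T x + B (x, T x))].
Proof.
move=> /andP[d0 d1].
(* The final estimate: replacing [z] by [A y] at distance [t] costs at most [t] on the left, as
   [d <= 1], and [2 t] in the norm of [G]. *)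
have arith (nz na t ga gz g : R) : nz <= na + t -> 0 <= t -> d * na <= ga ->
    ga <= gz + g -> g <= 2 * t -> d * nz <= gz + 3 * t.
  by nra.
have [C [symC contrC CA]] := sqrt_operator prod_complete A_sym A_contr.
(* [C] is symmetric with square [A], so both squared norms equal the product of [A z] and [z]. *)
have NC z : N2 (F z) = N (C z).
  apply/eqP; rewrite -(@eqrXn2 _ 2) ?dnormv_ge0 //; apply/eqP/complexI.
  by rewrite -!dotvv symC CA -A_sym dotA.
have [W [Wle WC]] : exists W : {linear Z -> H2},
    (forall z, N2 (W z) <= N z) /\ forall y, W (C y) = F y.
  apply: (@dense_extension _ _ _ _ pdot hdot prod_complete hilbert_complete C F).
  by move=> y; rewrite NC.
have lB : linear (fun z : Z => d%:C *: W (P z)).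
  by move=> a u v; rewrite lP linearP scalerDr !scalerA mulrC.
exists (linear_of lB); split=> [z|x xN|x Tx] /=.
- rewrite dnormvZr // ler_wpM2l //; apply: le_trans (Wle _) _.
  exact: orthoproj_le.
- rewrite orthoproj_perp ?linear0 ?scaler0 // => m [[_ mN] _].
  by apply: etrans (prod_dot0r _ _) _; rewrite dotC mN // rmorph0.
pose G (z : Z) := F z + d%:C *: W z.
have GB z z' : G (z - z') = G z - G z'.
  by rewrite /G (linearB F) (linearB W) scalerBr opprD addrACA.
have GA y : d * N (A y) <= N2 (G (A y)).
  have -> : G (A y) = F (C (C y) + d%:C *: C y).
    by rewrite /G -CA WC linearD linearZZ.
  rewrite NC linearD linearZZ (CA y).
  (* For [v = A y], comparing [(C + d) v] with [(1 + d) v] and using [|v - C v| <= |v|] gives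
     [|(C + d) v| >= d |v|]. *)
  have := dnormv_leD pdot ((1 + d)%:C *: A y) (C (A y) + d%:C *: A y).
  have -> : (1 + d)%:C *: A y - (C (A y) + d%:C *: A y) = A y - C (A y).
    by rewrite rmorphD scalerDl scale1r opprD addrACA subrr addr0.
  rewrite dnormvZr ?addr_ge0 //.
  have := contrC (A y); lra.
have Gle z : N2 (G z) <= 2 * N z.
  apply: le_trans (dnormvD _ _ _) _; rewrite dnormvZr //.
  have : N2 (F z) <= N z.
    by apply: le_trans (dnorm_snd_le _) _; exact: orthoproj_le.
  have := Wle z; have := dnormv_ge0 hdot (W z); nra.
set z := (x, T x).
have Mz : M z by [].
have Pz : P z = z by exact: orthoproj_id.
have -> : T x + d%:C *: W (P z) = G z by rewrite /G /= Pz.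
have [y yz] := range_dense Mz.
apply: (@le_trans _ _ (d * N z)); first by rewrite ler_wpM2l // (dnorm_fst_le z).
apply: (le_null_seq (null_seqZ 3 yz)) => n /=.
apply: (arith _ (N (A (y n))) _ (N2 (G (A (y n)))) _ (N2 (G (A (y n) - z)))).
- by rewrite (ddistC pdot (A (y n))) dnormv_leD.
- exact: dnormv_ge0.
- exact: GA.
- by rewrite GB dnormv_leD.
- exact: Gle.
Qed.

End PolarPart.

Lemma bounded_below_near T (e : R) : 0 < e -> exists S,
  [/\ bounded_below S, graph_near e S T, carrier_near e S T &
      nonzero_op T -> nonzero_op S].
Proof.
move=> e0; have [d [d0 d2 de]] := small_scale e0.
have d01 : 0 <= d <= 1 by rewrite ltW //= (le_trans d2) // invf_le1 ?ler1n.
have d012 : 0 <= d <= 2^-1 by rewrite ltW.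
have [B [Bd B0 BT]] := polar_part T d01.
exists (perturbation T d012 Bd); split.
- exact: (perturbation_bounded_below B0 d0).
- move=> z; apply: le_trans (perturbation_graph_near T d012 Bd z) _.
  by rewrite ler_wpM2r ?dnormv_ge0.
- move=> z; apply: le_trans (perturbation_carrier_near B0 d0 BT z) _.
  by rewrite ler_wpM2r ?dnormv_ge0.
- exact: (perturbation_nonzero B0 d0).
Qed.

(** * Rank one perturbations and attainment of the reduced minimum *)

Section RankOne.
Variables (u : H1) (w : H2).

Let rank_one_lin : linear (fun z : Z => hdot z.1 u *: w).
Proof. by move=> a y z; rewrite /= dotDl dotZl scalerDl scalerA. Qed.

Definition rank_one : {linear Z -> H2} := linear_of rank_one_lin.

Lemma rank_one_le z : N1 u = 1 -> N2 (rank_one z) <= N2 w * N z.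
Proof.
move=> u1; rewrite /= dnormvZ mulrC ler_wpM2l ?dnormv_ge0 //.
apply: le_trans (dot_cauchy_schwarz _ _ _) _.
by rewrite u1 mulr1 dnorm_fst_le.
Qed.

End RankOne.

(* The normalisation [hdot (y n) u = 1] makes [S] and [T] agree on the
   differences [y m - y n], on which the quadratic form
   [|S x|^2 - m |x|^2] is then coercive. *)
Lemma attaining_of_drop T S (u : H1) (g d : R) (k : H2) :
  0 < d < g -> N1 u = 1 -> carrier T u -> N2 k = d ->
  (forall x, carrier T x -> g * N1 x <= N2 (T x)) ->
  carrier S = carrier T -> (forall x, S x = T x + hdot x u *: k) ->
  N2 (S u) < g -> reduced_min_attaining S.
Proof.
move=> /andP[d0 dg] u1 Tu kd gT cST SE Sug.
have sC := carrier_subspace T.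
pose D := [set N2 (S x) ^+ 2 | x in [set x | carrier T x /\ N1 x = 1]].
have D0 : has_inf D.
  split; first by exists (N2 (S u) ^+ 2), u.
  by exists 0 => _ [x _ <-]; exact: sqr_ge0.
set m := inf D.
have m0 : 0 <= m by apply: lb_le_inf; [exact: D0.1 | move=> _ [x _ <-]; exact: sqr_ge0].
have mD x : carrier T x -> N1 x = 1 -> m <= N2 (S x) ^+ 2.
  by move=> Tx x1; apply: ge_inf; [exact: D0.2 | exists x].
have g0 : 0 < g by lra.
have mg : m < g ^+ 2.
  apply: le_lt_trans (mD _ Tu u1) _.
  by rewrite ltrXn2r ?nnegrE ?dnormv_ge0 ?ltW.
have domS x : carrier T x -> dom S x by rewrite -cST => -[].
have mS x : carrier T x -> m * N1 x ^+ 2 <= N2 (S x) ^+ 2.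
  move=> Tx; have [->|x0] := eqVneq x 0; first by rewrite dnorm0 expr0n mulr0 sqr_ge0.
  have Nx : 0 < N1 x by rewrite dnormv_gt0.
  have := mD ((N1 x)^-1%:C *: x) (subspaceZ sC _ Tx).
  rewrite opZ; last exact: domS.
  rewrite !dnormvZr ?invr_ge0 ?dnormv_ge0 // mulVf ?gt_eqF // => /(_ erefl).
  by rewrite exprMn exprVn ler_pdivlMl ?exprn_gt0 // mulrC.
pose r := fun v : H1 => N2 (S v) ^+ 2 - m * N1 v ^+ 2.
(* The parallelogram law for the quadratic form [r], with the nonnegative term [r (x + y)]
   dropped. *)
have r_par : forall x y, carrier T x -> carrier T y -> r (x - y) <= 2 * r x + 2 * r y.
  move=> x y Tx Ty; have := mS _ (subspaceD sC Tx Ty); rewrite /r.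
  have := parallelogram hdot x y; have := parallelogram hdot (S x) (S y).
  rewrite -(opD (domS _ Tx) (domS _ Ty)) -(opB (domS _ Tx) (domS _ Ty)).
  move: (N1 (x + y) ^+ 2) (N1 (x - y) ^+ 2) (N2 (S (x + y)) ^+ 2) => a b c.
  move: (N2 (S (x - y)) ^+ 2) (N1 x ^+ 2) (N1 y ^+ 2) => a' b' c'.
  move: (N2 (S x) ^+ 2) (N2 (S y) ^+ 2) => a'' b''.
  move=> ST HT; have -> : b = 2 * b' + 2 * c' - a by lra.
  by nra.
(* Half of the room between [m] and [g ^+ 2]: every term [x n] below then satisfies
   [|S (x n)| <= k0 < g]. *)
pose eta := (g ^+ 2 - m) / 2.
have eta0 : 0 < eta by rewrite /eta divr_gt0 // subr_gt0.
have /choice[x xP] n : exists x, [/\ carrier T x, N1 x = 1 &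
    N2 (S x) ^+ 2 < m + eta * n.+1%:R^-1].
  have en : 0 < eta * n.+1%:R^-1 by rewrite mulr_gt0 ?invr_gt0.
  by have [_ [x [Tx x1] <-] xs] := inf_adherent en D0; exists x.
have me0 : 0 <= m + eta by rewrite addr_ge0 // ltW.
pose k0 := Num.sqrt (m + eta).
have k0g : k0 < g.
  rewrite -(@ltr_pXn2r _ 2) ?nnegrE ?sqrtr_ge0 ?(ltW g0) // (sqr_sqrtr me0).
  by rewrite /eta; lra.
(* As [|T (x n)| >= g] and [|S (x n)| <= k0], the rank one term has norm at least [g - k0]. So the
   coefficients [c n] stay away from zero and one may divide by them. *)
pose rho := (g - k0) / d.
have rho0 : 0 < rho by rewrite divr_gt0 ?subr_gt0.
pose c n := hdot (x n) u.
have c_ge n : rho <= normc (c n).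
  have [Tx x1 xs] := xP n.
  have Sk : N2 (S (x n)) <= k0.
    rewrite /k0 -(@ler_pXn2r _ 2) ?nnegrE ?sqrtr_ge0 ?dnormv_ge0 // (sqr_sqrtr me0).
    apply: le_trans (ltW xs) _; rewrite lerD2l ler_piMr ?(ltW eta0) //.
    by rewrite invf_le1 // ler1n.
  have := gT _ Tx; rewrite x1 mulr1 => gx.
  have : N2 (T (x n)) <= N2 (S (x n)) + normc (c n) * d.
    have -> : T (x n) = S (x n) - c n *: k by rewrite SE addrK.
    by apply: le_trans (dnormvB _ _ _) _; rewrite dnormvZ kd.
  rewrite ler_pdivrMr //; lra.
have c0 n : c n != 0.
  by apply: contraTneq (c_ge n) => ->; rewrite normc0 -ltNge.
pose y n := (c n)^-1 *: x n.
have Ty n : carrier T (y n) by apply: subspaceZ => //; have [] := xP n.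
have yu n : hdot (y n) u = 1 by rewrite dotZl mulVf.
pose q := rho ^- 2 * eta.
have q0 : 0 < q by rewrite mulr_gt0 // invr_gt0 exprn_gt0.
have ry n : r (y n) <= q * n.+1%:R^-1.
  have [Tx x1 xs] := xP n.
  have -> : r (y n) = (normc (c n)) ^- 2 * r (x n).
    by rewrite /r /y (opZ _ (domS _ Tx)) !dnormvZ normcV !exprMn exprVn; ring.
  have rx0 : 0 <= r (x n) by rewrite subr_ge0 mS.
  have rx : r (x n) <= eta * n.+1%:R^-1.
    by rewrite /r x1 expr1n mulr1; move: xs; move: (eta * _) => ?; lra.
  rewrite /q -mulrA ler_pM ?invr_ge0 ?exprn_ge0 ?normc_ge0 //.
  have cg : 0 < normc (c n) by exact: lt_le_trans (c_ge n).
  by rewrite lef_pV2 ?posrE ?exprn_gt0 // lerXn2r ?nnegrE ?(ltW rho0) ?(ltW cg) //.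
pose b n : Z := (y n, S (y n)).
have bG n : carrier_graph S (b n) by apply: carrier_graph_in; rewrite cST.
(* On [v = y n - y p] the operators agree, so [r v >= (g ^+ 2 - m) |v|^2], while the squared graph
   norm of [v] is [(1 + m) |v|^2 + r v]. *)
have coer n p : N (b n - b p) ^+ 2 <=
    ((1 + m) / (g ^+ 2 - m) + 1) * r (y n - y p).
  have Tyy := subspaceB sC (Ty n) (Ty p).
  have Sy : S (y n - y p) = T (y n - y p).
    by rewrite SE dotBl !yu subrr scale0r addr0.
  have gy : g ^+ 2 * N1 (y n - y p) ^+ 2 <= N2 (S (y n - y p)) ^+ 2.
    by rewrite -exprMn Sy lerXn2r ?nnegrE ?mulr_ge0 ?dnormv_ge0 ?(ltW g0) // gT.
  rewrite prod_dnorm_sqr /= -(opB (domS _ (Ty n)) (domS _ (Ty p))).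
  have Ey : N1 (y n - y p) ^+ 2 <= r (y n - y p) / (g ^+ 2 - m).
    by rewrite ler_pdivlMr ?subr_gt0 // /r; move: gy; nra.
  have -> : N2 (S (y n - y p)) ^+ 2 = r (y n - y p) + m * N1 (y n - y p) ^+ 2.
    by rewrite /r subrK.
  have := ler_wpM2l (ltac:(lra) : 0 <= 1 + m) Ey.
  by move: (r _) (N1 _ ^+ 2) ((g ^+ 2 - m)^-1) => a1 a2 a3; nra.
pose Q := (1 + m) / (g ^+ 2 - m) + 1.
have Q0 : 0 <= Q.
  by apply: addr_ge0 => //; apply: divr_ge0; [exact: addr_ge0 | rewrite subr_ge0 ltW].
have cb : dcauchy pdot b.
  apply: (@dcauchy_sqr _ _ _ b (fun n => Q * (2 * q) * n.+1%:R^-1)).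
  - by apply: null_seqZ; exact: null_seq_harmonic.
  - by move=> n; rewrite mulr_ge0 ?invr_ge0 // mulr_ge0 // mulr_ge0 // ltW.
  move=> i j; apply: le_trans (coer i j) _; rewrite -/Q.
  have -> : forall a b, Q * (2 * q) * a + Q * (2 * q) * b = Q * (2 * (q * a) + 2 * (q * b)).
    by move=> ? ?; ring.
  apply: ler_wpM2l => //; apply: le_trans (r_par _ _ (Ty i) (Ty j)) _.
  by apply: lerD; rewrite ler_pM2l //; exact: ry.
have [[z Sz] [/= Sz1 ->] bz] := carrier_graph_complete bG cb.
have yz : dlim hdot y z by exact: dlim_fst bz.
have Syz : dlim hdot (fun n => S (y n)) (S z) by exact: dlim_snd bz.
(* The product of [y n] with the unit vector [u] is 1, so [|y n| >= 1] and the limit cannot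
   vanish. *)
have z0 : 0 < N1 z.
  rewrite dnormv_gt0; apply/eqP => z0; have : (1 : R) <= 0.
    apply: (le_null_seq yz) => n; rewrite z0 subr0 add0r.
    by rewrite -(normc1 R) -(yu n) (le_trans (dot_cauchy_schwarz _ _ _)) // u1 mulr1.
  by rewrite ler10.
have Szle : N2 (S z) <= Num.sqrt m * N1 z.
  have r0 : null_seq (fun n => Num.sqrt (q * n.+1%:R^-1)).
    exact/null_seq_sqrt/null_seqZ/null_seq_harmonic.
  apply: (le_null_seq (null_seqD r0 (null_seqD Syz (null_seqZ (Num.sqrt m) yz)))) => n.
  have Sy : N2 (S (y n)) <= Num.sqrt m * N1 (y n) + Num.sqrt (q * n.+1%:R^-1).
    rewrite -(@ler_pXn2r _ 2) ?nnegrE ?addr_ge0 ?mulr_ge0 ?sqrtr_ge0 ?dnormv_ge0 //.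
    have qn0 : 0 <= q * n.+1%:R^-1 by rewrite mulr_ge0 ?invr_ge0 // ltW.
    rewrite sqrrD exprMn (sqr_sqrtr m0) (sqr_sqrtr qn0).
    have := ry n; rewrite /r.
    have : 0 <= Num.sqrt m * N1 (y n) * Num.sqrt (q / n.+1%:R).
      by rewrite !mulr_ge0 ?sqrtr_ge0 ?dnormv_ge0.
    move: (q / _) (_ * Num.sqrt _) (N2 _ ^+ 2) (m * _) => a1 a2 a3 a4; lra.
  have := dnormv_leD hdot (S z) (S (y n)); rewrite (ddistC hdot (S z)).
  have := ler_wpM2l (sqrtr_ge0 m) (dnormv_leD hdot (y n) z); rewrite mulrDr.
  lra.
have Cz : carrier S ((N1 z)^-1%:C *: z) by exact: subspaceZ (carrier_subspace S) _ _ _.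
apply: (attaining_intro Cz).
  by rewrite dnormvZr ?invr_ge0 ?dnormv_ge0 // mulVf ?gt_eqF.
move=> v; rewrite cST => Tv v1.
rewrite opZ; last by case: Sz1.
rewrite dnormvZr ?invr_ge0 ?dnormv_ge0 // ler_pdivrMl //.
apply: le_trans Szle _; rewrite mulrC ler_pM2l //.
by rewrite -(ger0_norm (dnormv_ge0 hdot (S v))) -sqrtr_sqr ler_wsqrtr // mD.
Qed.

Lemma nonzero_carrier T : nonzero_op T -> exists2 x, carrier T x & N1 x = 1.
Proof.
move=> [x Tx Tx0]; have [n [c [_ Tc _ E]]] := carrier_decomposition Tx.
have c0 : 0 < N1 c by rewrite dnormv_gt0; apply: contra_neq Tx0 => c0; rewrite E c0 op0.
exists ((N1 c)^-1%:C *: c); first exact: subspaceZ (carrier_subspace T) _ _ _.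
by rewrite dnormvZr ?invr_ge0 ?dnormv_ge0 // mulVf ?gt_eqF.
Qed.

(** Choose a unit vector [u] of the carrier with [|T u| < g + d]. The rank one term shortens [T u]
    by exactly [d], bringing its norm below [g], and leaves [S] bounded below by [g - d] on the
    carrier. *)
Lemma attaining_near T (e : R) : 0 < e -> bounded_below T -> nonzero_op T ->
  exists S, [/\ reduced_min_attaining S, graph_near e S T & carrier_near e S T].
Proof.
move=> e0 [c c0 cT] /nonzero_carrier[v Tv v1].
pose D := [set N2 (T x) | x in [set x | carrier T x /\ N1 x = 1]].
have Dc : lbound D c by move=> _ [x [Tx x1] <-]; have := cT _ Tx; rewrite x1 mulr1.
have D0 : has_inf D by split; [exists (N2 (T v)), v | exists c].
set g := inf D.
have g0 : 0 < g by apply: lt_le_trans c0 _; exact: lb_le_inf D0.1 Dc.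
have gT x : carrier T x -> g * N1 x <= N2 (T x).
  move=> Tx; have [->|x0] := eqVneq x 0; first by rewrite dnorm0 mulr0 dnormv_ge0.
  have Nx : 0 < N1 x by rewrite dnormv_gt0.
  have : g <= N2 (T ((N1 x)^-1%:C *: x)).
    apply: ge_inf; first exact: D0.2.
    exists ((N1 x)^-1%:C *: x) => //; split.
      exact: subspaceZ (carrier_subspace T) _ _ _.
    by rewrite dnormvZr ?invr_ge0 ?dnormv_ge0 // mulVf ?gt_eqF.
  rewrite opZ; last by case: Tx.
  by rewrite dnormvZr ?invr_ge0 ?dnormv_ge0 // ler_pdivlMl // mulrC.
(* The bound by [e] controls the gaps; the bound by [g] keeps [g - d] positive. *)
have [d [d0 d2 dm]] := small_scale (ltac:(by rewrite lt_min e0 g0) : 0 < Num.min e g).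
have de : 4 * d <= e by rewrite (le_trans dm) // ge_min lexx.
have dg : 4 * d <= g by rewrite (le_trans dm) // ge_min lexx orbT.
have d012 : 0 <= d <= 2^-1 by rewrite ltW.
have [_ [u [Tu u1] <-] ug] := inf_adherent d0 D0.
have gu : g <= N2 (T u) by have := gT _ Tu; rewrite u1 mulr1.
have Nu : 0 < N2 (T u) by exact: lt_le_trans gu.
pose w := - ((d / N2 (T u))%:C *: T u).
have wd : N2 w = d by rewrite dnormvN dnormvZr ?divr_ge0 ?ltW // divfK ?gt_eqF.
have Bd z : N2 (rank_one u w z) <= d * N z by rewrite -wd; exact: rank_one_le.
have B0 x : null_space T x -> rank_one u w (x, 0) = 0.
  by move=> Tx /=; case: Tu => _ uN; rewrite dotC uN // rmorph0 scale0r.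
pose S := perturbation T d012 Bd.
have SE x : S x = T x + hdot x u *: w by [].
have gd0 : 0 < g - d by lra.
have cS x : carrier T x -> (g - d) * N1 x <= N2 (S x).
  move=> Tx; have := dnormv_leD hdot (T x) (S x).
  have -> : T x - S x = - (hdot x u *: w) by rewrite SE opprD addrA subrr add0r.
  rewrite dnormvN dnormvZ wd.
  have := ler_wpM2r (ltW d0) (dot_cauchy_schwarz hdot x u); rewrite u1 mulr1.
  have := gT _ Tx; nra.
have CST : carrier S = carrier T by exact: perturbation_carrier gd0 cS.
exists S; split.
- have d_g : 0 < d < g by lra.
  apply: (attaining_of_drop d_g u1 Tu wd gT CST SE).
  rewrite SE dotvv u1 expr1n scale1r.
  have -> : T u + w = (1 - d / N2 (T u))%:C *: T u.
    by rewrite rmorphB scalerBl scale1r.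
  rewrite dnormvZr.
    rewrite mulrBl mul1r divfK ?gt_eqF //; lra.
  by rewrite subr_ge0 ler_pdivrMr // mul1r; lra.
- move=> z; apply: le_trans (perturbation_graph_near T d012 Bd z) _.
  by rewrite ler_wpM2r ?dnormv_ge0.
- move=> z; apply: le_trans (perturbation_carrier_near B0 gd0 cS z) _.
  by rewrite ler_wpM2r ?dnormv_ge0.
Qed.

Lemma infinite_dimensional_nonzero (H : hilbertType R) :
  infinite_dimensional H -> exists x : H, x != 0.
Proof.
move=> /(_ [::])[x xP]; exists x; apply/eqP => x0; apply: xP.
by exists (fun=> 0); rewrite big_ord0.
Qed.

(** Such a [T] vanishes on its domain and its carrier has no unit vector to start from. Adding a
    rank one term built on any unit vector [u] of the domain gives an operator whose norm is
    constantly [d] on its carrier sphere. *)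
Lemma zero_op_attaining_near T (e : R) : infinite_dimensional H1 ->
  infinite_dimensional H2 -> 0 < e -> ~ nonzero_op T ->
  exists S, reduced_min_attaining S /\ graph_near e S T.
Proof.
move=> /infinite_dimensional_nonzero[v v0] /infinite_dimensional_nonzero[k k0] e0 T0.
have Tx0 x : dom T x -> T x = 0.
  by move=> Tx; apply/eqP; apply: contra_notT T0 => Tx0; exists x.
have [u Tu u1] : exists2 u, dom T u & N1 u = 1.
  (* The dense domain meets the open complement of zero. *)
  have [||x [/= x0 Tx]] := @dom_dense _ _ _ T (~` [set 0]).
  - by exists v => /eqP; exact/negP.
  - apply: closed_openC; apply: accessible_closed_set1.
    exact/hausdorff_accessible/norm_hausdorff.
  exists ((N1 x)^-1%:C *: x); first exact: subspaceZ (domP T) _ _ _.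
  rewrite dnormvZr ?invr_ge0 ?dnormv_ge0 // mulVf // dnormv_eq0.
  exact/eqP.
have [d [d0 d2 de]] := small_scale e0.
have d012 : 0 <= d <= 2^-1 by rewrite ltW.
pose w := (d / N2 k)%:C *: k.
have wd : N2 w = d.
  by rewrite dnormvZr ?divr_ge0 ?dnormv_ge0 ?(ltW d0) // divfK // dnormv_eq0.
have Bd z : N2 (rank_one u w z) <= d * N z by rewrite -wd; exact: rank_one_le.
pose S := perturbation T d012 Bd.
have SE x : dom T x -> S x = hdot x u *: w.
  by move=> Tx; rewrite perturbationE /= Tx0 // add0r.
have uu : hdot u u = 1 by rewrite dotvv u1 expr1n.
have NS x : dom T x -> N2 (S x) = normc (hdot x u) * d.
  by move=> Tx; rewrite SE // dnormvZ wd.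
exists S; split; last first.
  move=> z; apply: le_trans (perturbation_graph_near T d012 Bd z) _.
  by rewrite ler_wpM2r ?dnormv_ge0.
have w0 : w != 0 by rewrite -(dnormv_eq0 hdot) wd gt_eqF.
apply: (attaining_intro (x := u)) => //.
  split=> // y [Ty]; rewrite SE // => /eqP; rewrite scaler_eq0 (negPf w0) orbF.
  by move=> /eqP yu; rewrite dotC yu rmorph0.
move=> y [Ty yN] y1; rewrite !NS // uu normc1 ler_pM2r //.
(* The vector [y - hdot y u *: u] is in the null space of [S], hence orthogonal to [y]. This forces
   [hdot y u] to have modulus 1. *)
have : hdot y (y - hdot y u *: u) = 0.
  apply: yN; split; first by apply: (subspaceB (domP T)) => //; exact: subspaceZ (domP T) _ _ _.
  rewrite SE; last by apply: (subspaceB (domP T)) => //; exact: subspaceZ (domP T) _ _ _.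
  by rewrite dotBl dotZl uu mulr1 subrr scale0r.
rewrite dotBr dotvv y1 dotZr mulrC normc_sqr expr1n => /eqP.
rewrite subr_eq0 => /eqP/complexI E.
by rewrite -(@ler_pXn2r _ 2) ?nnegrE ?normc_ge0 // -E expr1n.
Qed.

End Approximation.

(** * Density for the gap and carrier graph metrics *)

Theorem theorem3p24 (R : realType) (H1 H2 : hilbertType R)
    (infH1 : infinite_dimensional H1) (infH2 : infinite_dimensional H2) :
  [/\ dense_wrt (@gap_metric R H1 H2) reduced_min_attaining setT,
      dense_wrt (@carrier_graph_metric R H1 H2) reduced_min_attaining nonzero_op,
      dense_wrt (@gap_metric R H1 H2) closed_range setT &
      dense_wrt (@carrier_graph_metric R H1 H2) closed_range setT].
Proof.
(* Half of [e] is spent on making [T] bounded below while keeping it nonzero, the other half on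
   attaining the minimum. *)
have near (T : cdop H1 H2) (e : R) : nonzero_op T -> 0 < e -> exists S,
    [/\ reduced_min_attaining S, graph_near e S T & carrier_near e S T].
  move=> T0 e0; have e2 : 0 < e / 2 by rewrite divr_gt0.
  have [S [Sb ST ST' /(_ T0) S0]] := bounded_below_near T e2.
  have [U [Ua US US']] := attaining_near e2 Sb S0.
  exists U; rewrite [e](splitr e); split=> //.
  - exact: graph_near_trans US ST.
  - exact: carrier_near_trans US' ST'.
(* The metrics are suprema, so pointwise bounds give only weak inequalities; approximating within
   [e / 2] makes them strict. *)
have half (e : R) : 0 < e -> 0 <= e / 2 < e by move=> e0; lra.
have half0 (e : R) : 0 < e -> 0 < e / 2 by move=> e0; lra.
split=> [T _ e e0|T T0 e e0|T _ e e0|T _ e e0].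
- have [T0|T0] := pselect (nonzero_op T).
    have [S [Sa ST _]] := near T _ T0 (half0 _ e0).
    by exists S => //; exact: gap_metric_lt (half _ e0) ST.
  have [S [Sa ST]] := zero_op_attaining_near infH1 infH2 (half0 _ e0) T0.
  by exists S => //; exact: gap_metric_lt (half _ e0) ST.
- have [S [Sa _ ST]] := near T _ T0 (half0 _ e0).
  by exists S => //; exact: carrier_graph_metric_lt (half _ e0) ST.
- have [S [Sb ST _ _]] := bounded_below_near T (half0 _ e0).
  by exists S; [exact: bounded_below_closed_range | exact: gap_metric_lt (half _ e0) ST].
- have [S [Sb _ ST _]] := bounded_below_near T (half0 _ e0).
  by exists S; [exact: bounded_below_closed_range | exact: carrier_graph_metric_lt (half _ e0) ST].
Qed.
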